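(* Let $k$ be an algebraically closed field of characteristic $0$, let $\Lambda$ be a free abelian group of rank $n\ge1$, and let $\mathcal B$ be a $\Lambda$-graded algebra over $k$. Then $\mathcal B$ has a multiloop realization based on a finite dimensional simple algebra if and only if $\mathcal B$ is graded-central-simple, $\mathcal B$ is fgc, and $\Gamma(\mathcal B)$ has finite index in $\Lambda$. Moreover, if there exists a positive integer $\ell$ such that $\ell\Lambda\subseteq\mathrm{supp}_\Lambda(\mathcal B)$, then $\mathcal B$ has a multiloop realization based on a finite dimensional simple algebra if and only if $\mathcal B$ is graded-central-simple and fgc.
   Context: All algebras are over $k$ and not necessarily associative or unital. A $\Lambda$-graded algebra is an algebra $\mathcal B=\bigoplus_{\lambda\in\Lambda}\mathcal B^\lambda$ with $\mathcal B^\lambda\mathcal B^\mu\subseteq\mathcal B^{\lambda+\mu}$; $\mathrm{supp}_\Lambda(\mathcal B)=\{\lambda:\mathcal B^\lambda\neq0\}$. A $\Lambda$-graded algebra $\mathcal B$ and a $\Lambda'$-graded algebra $\mathcal B'$ are isograded-isomorphic, $\mathcal B\simeq_{\mathrm{ig}}\mathcal B'$, if there are an algebra isomorphism $\varphi:\mathcal B\to\mathcal B'$ and a group isomorphism $\nu:\Lambda\to\Lambda'$ with $\varphi(\mathcal B^\lambda)=\mathcal B'^{\,\nu(\lambda)}$ for all $\lambda$. Centroid: $C(\mathcal B)$ is the centralizer in $\mathrm{End}_k(\mathcal B)$ of the unital subalgebra generated by all left and right multiplications by elements of $\mathcal B$; $C(\mathcal B)^\lambda=\{c\in C(\mathcal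 B):c(\mathcal B^\mu)\subseteq\mathcal B^{\lambda+\mu}\ \forall\mu\}$. $\mathcal B$ is simple (resp. graded-simple) if $\mathcal B\mathcal B\neq0$ and its only ideals (resp. graded ideals) are $0,\mathcal B$; graded-central if $C(\mathcal B)^0=k1$; graded-central-simple = graded-central and graded-simple. For $\mathcal B$ graded-simple, $\Gamma(\mathcal B)=\{\lambda\in\Lambda:C(\mathcal B)^\lambda\neq0\}$, a subgroup of $\Lambda$. $\mathcal B$ is fgc if it is finitely generated as a $C(\mathcal B)$-module. Multiloop algebras: fix primitive $\ell$-th roots of unity $\zeta_\ell\in k$ for all $\ell\ge1$ with $\zeta_{m\ell}^m=\zeta_\ell$ for all $\ell,m\ge1$. Given $\mathbf m=(m_1,\dots,m_n)$ positive integers, an algebra $\mathcal A$ and pairwise commuting automorphisms $\sigma_1,\dots,\sigma_n$ of $\mathcal A$ with $\sigma_i^{m_i}=1$, put $\mathcal A^{(\bar\ell_1,\dots,\bar\ell_n)}=\{u\in\mathcal A:\sigma_ju=\zeta_{m_j}^{\ell_j}u,\ 1\le j\le n\}$ where $\bar\ell_j=\ell_j+m_j\mathbb Z$, and $M_{\mathbf m}(\mathcal A,\sigma_1,\dots,\sigma_n)=\sum_{(\ell_1,\dots,\ell_n)\in\mathbb Z^n}\mathcal A^{(\bar\ell_1,\dots,\bar\ell_n)}\otimes z_1^{\ell_1}\cdots z_n^{\ell_n}\subseteq\mathcal A\otimes_kk[z_1^{\pm1},\dots,z_n^{\pm1}]$, a $\mathbb Z^n$-graded algebra whose component of degree $(\ell_1,\dots,\ell_n)$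 is the corresponding summand. $\mathcal B$ has a multiloop realization based on $\mathcal A$ if $\mathcal B\simeq_{\mathrm{ig}}M_{\mathbf m}(\mathcal A,\sigma_1,\dots,\sigma_n)$ for some $n$-tuple $\mathbf m$ of positive integers and some commuting automorphisms $\sigma_1,\dots,\sigma_n$ of $\mathcal A$ with $\sigma_i^{m_i}=1$ for all $i$. *)

(* Defs.v *)
From HB Require Import structures.
From mathcomp Require Import all_boot all_order all_algebra.
From mathcomp Require Import finmap.
From mathcomp Require Import boolp classical_sets functions cardinality fsbigop.

Set Implicit Arguments.
Unset Strict Implicit.
Unset Printing Implicit Defensive.

Import Order.TTheory GRing.Theory.

Local Open Scope classical_set_scope.
Local Open Scope ring_scope.

Record algebra (k : fieldType) := Algebra {
  algebra_sort :> lmodType k;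
  amul : {bilinear algebra_sort -> algebra_sort -> algebra_sort} }.

Arguments amul {k a}.

Definition ideal (k : fieldType) (B : algebra k) (I : set B) : Prop :=
  submod_closed [in I] /\
  forall b x : B, I x -> I (amul b x) /\ I (amul x b).

Definition simple (k : fieldType) (B : algebra k) : Prop :=
  (exists x y : B, amul x y != 0) /\
  forall I : set B, ideal I -> I = [set 0] \/ I = setT.

Record automorphism (k : fieldType) (A : algebra k) := Automorphism {
  aut_fun :> {linear A -> A};
  aut_mul : forall x y : A, aut_fun (amul x y) = amul (aut_fun x) (aut_fun y);
  aut_bij : bijective aut_fun }.

(* The unital subalgebra of End_k(B) generated by the left and right
   multiplications. *)
Inductive mult_algebra (k : fieldType) (B : algebra k) : set (B -> B) :=
| MultId : mult_algebra idfun
| MultLeft (b : B) : mult_algebra (fun x => amul b x)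
| MultRight (b : B) : mult_algebra (fun x => amul x b)
| MultLin (a : k) (f g : B -> B) :
    mult_algebra f -> mult_algebra g -> mult_algebra (fun x => a *: f x + g x)
| MultComp (f g : B -> B) :
    mult_algebra f -> mult_algebra g -> mult_algebra (f \o g).

Definition centroid (k : fieldType) (B : algebra k) : set (B -> B) :=
  [set c | linear c /\ forall f, mult_algebra f -> c \o f = f \o c].

Definition fgc (k : fieldType) (B : algebra k) : Prop :=
  exists (r : nat) (b : 'I_r -> B), forall x : B,
    exists c : 'I_r -> B -> B,
      (forall i, centroid (c i)) /\ x = \sum_(i < r) c i (b i).

(* For a family of subspaces, s may have repetitions without changing the sum. *)
Definition subspace_sum (k : fieldType) (V : lmodType k) (Lam : zmodType)
    (S : Lam -> set V) : set V :=
  [set x | exists (s : seq Lam) (f : Lam -> V),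
     (forall l, S l (f l)) /\ x = \sum_(l <- s) f l].

Definition subspace_independent (k : fieldType) (V : lmodType k)
    (Lam : zmodType) (S : Lam -> set V) : Prop :=
  forall (s : seq Lam) (f : Lam -> V), uniq s -> (forall l, S l (f l)) ->
    \sum_(l <- s) f l = 0 -> forall l, l \in s -> f l = 0.

Record gradedAlgebra (k : fieldType) (Lam : zmodType) := GradedAlgebra {
  graded_algebra :> algebra k;
  hcomp : Lam -> set graded_algebra;
  hcomp_submod : forall l, submod_closed [in hcomp l];
  hcomp_sum : subspace_sum hcomp = setT;
  hcomp_independent : subspace_independent hcomp;
  hcomp_mul : forall l m x y,
    hcomp l x -> hcomp m y -> hcomp (l + m) (amul x y) }.

Arguments hcomp {k Lam} g.

Definition supp (k : fieldType) (Lam : zmodType) (B : gradedAlgebra k Lam) :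
    set Lam :=
  [set l | hcomp B l <> [set 0]].

Definition graded_ideal (k : fieldType) (Lam : zmodType)
    (B : gradedAlgebra k Lam) (I : set B) : Prop :=
  ideal I /\ I = subspace_sum (fun l => I `&` hcomp B l).

Definition graded_simple (k : fieldType) (Lam : zmodType)
    (B : gradedAlgebra k Lam) : Prop :=
  (exists x y : B, amul x y != 0) /\
  forall I : set B, graded_ideal I -> I = [set 0] \/ I = setT.

Definition centroid_comp (k : fieldType) (Lam : zmodType)
    (B : gradedAlgebra k Lam) (l : Lam) : set (B -> B) :=
  [set c | centroid c /\ forall m x, hcomp B m x -> hcomp B (l + m) (c x)].

Arguments centroid_comp {k Lam} B l.

Definition graded_central (k : fieldType) (Lam : zmodType)
    (B : gradedAlgebra k Lam) : Prop :=
  centroid_comp B 0 = [set (fun x : B => a *: x) | a in [set: k]].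

Definition graded_central_simple (k : fieldType) (Lam : zmodType)
    (B : gradedAlgebra k Lam) : Prop :=
  graded_central B /\ graded_simple B.

Definition Gamma (k : fieldType) (Lam : zmodType) (B : gradedAlgebra k Lam) :
    set Lam :=
  [set l | centroid_comp B l <> [set (fun _ : B => 0)]].

Definition isograded_isomorphic (k : fieldType) (Lam Lam' : zmodType)
    (B : gradedAlgebra k Lam) (B' : gradedAlgebra k Lam') : Prop :=
  exists (phi : {linear B -> B'}) (nu : {additive Lam -> Lam'}),
    [/\ bijective phi, bijective nu,
        forall x y : B, phi (amul x y) = amul (phi x) (phi y) &
        forall l, phi @` hcomp B l = hcomp B' (nu l)].

Definition free_of_rank (Lam : zmodType) (n : nat) : Prop :=
  exists e : 'I_n -> Lam,
    bijective (fun c : 'rV[int]_n => \sum_(i < n) e i *~ c 0 i).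

Definition finite_index (Lam : zmodType) (H : set Lam) : Prop :=
  finite_set [set [set l + h | h in H] | l in [set: Lam]].

(* laurent A n models the tensor product of A with the ring of Laurent
   polynomials in z_1, ..., z_n: the element \sum_l f l (x) z^l is represented
   by its finitely supported family of coefficients f : Z^n -> A. *)
Section Laurent.
Variables (k : fieldType) (A : algebra k) (n : nat).
Local Notation Zn := 'rV[int]_n.

Definition fin_supported : {pred (Zn -> A)} :=
  fun f => `[< finite_set [set l | f l != 0] >].

Lemma fin_supportedP (f : Zn -> A) :
  reflect (finite_set [set l | f l != 0]) (f \in fin_supported).
Proof. exact: asboolP. Qed.

Lemma fin_supported_submod : submod_closed fin_supported.
Proof.
split=> [|a f g /fin_supportedP ff /fin_supportedP fg].
  apply/fin_supportedP; rewrite (_ : [set _ | _] = set0) //.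
  by rewrite -subset0 => l /=; rewrite eqxx.
apply/fin_supportedP.
have : finite_set ([set l | f l != 0] `|` [set l | g l != 0]).
  by rewrite finite_setU.
apply: sub_finite_set => l /=; apply: contraPP.
move=> /not_orP[/negP/negPn/eqP fl0 /negP/negPn/eqP gl0].
apply/negP/negPn/eqP.
by rewrite (_ : (a *: f + g) l = a *: f l + g l) // fl0 gl0 scaler0 addr0.
Qed.

HB.instance Definition _ :=
  GRing.isSubmodClosed.Build k (Zn -> A) fin_supported fin_supported_submod.

Record laurent := Laurent {
  coef :> Zn -> A;
  coef_fin : coef \in fin_supported }.

HB.instance Definition _ := [isSub for coef].
HB.instance Definition _ := [Choice of laurent by <:].
HB.instance Definition _ := [SubChoice_isSubLmodule of laurent by <:].

Lemma laurentP (f g : laurent) : f =1 g -> f = g.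
Proof. by move=> fg; apply: val_inj; apply/funext. Qed.

Lemma coefD (f g : laurent) l : (f + g) l = f l + g l. Proof. by []. Qed.
Lemma coefZ a (f : laurent) l : (a *: f) l = a *: f l. Proof. by []. Qed.
Lemma coef0 l : (0 : laurent) l = 0. Proof. by []. Qed.

Lemma coef_sum (I : Type) (s : seq I) (F : I -> laurent) l :
  (\sum_(i <- s) F i) l = \sum_(i <- s) F i l.
Proof. by elim/big_rec2: _ => // i y x _ <-. Qed.

Definition lsupp (f : laurent) : {fset Zn} :=
  fset_set [set l | f l != 0].

Lemma mem_lsupp (f : laurent) l : (l \in lsupp f) = (f l != 0).
Proof.
rewrite in_fset_set; last exact/fin_supportedP/coef_fin.
by apply/idP/idP; rewrite inE.
Qed.

Definition conv (f g : laurent) : Zn -> A :=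
  fun l => \sum_(i \in [set: Zn]) amul (f i) (g (l - i)).

Lemma conv_fset (X : {fset Zn}) (f g : laurent) l :
  (lsupp f `<=` X)%fset ->
  conv f g l = \sum_(i <- X) amul (f i) (g (l - i)).
Proof.
move=> fX; apply: fsbigTE => i iX.
have : i \notin lsupp f by apply: contra iX; exact/fsubsetP.
by rewrite mem_lsupp negbK => /eqP ->; rewrite linear0l.
Qed.

Lemma conv_fin (f g : laurent) : conv f g \in fin_supported.
Proof.
apply/fin_supportedP.
have : finite_set [set i + j | i in [set` lsupp f] & j in [set` lsupp g]].
  by apply: finite_image2; exact: finite_fset.
apply: sub_finite_set => l /=; rewrite (conv_fset _ _ (fsubset_refl _)).
apply: contraPP => nl; apply/negP/negPn/eqP; rewrite big_seq big1 // => i fi.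
have [->|gli] := eqVneq (g (l - i)) 0; first by rewrite linear0r.
case: nl; exists i => //; exists (l - i); last by rewrite addrC subrK.
by rewrite /= mem_lsupp.
Qed.

Definition laurent_mul (f g : laurent) : laurent := Laurent (conv_fin f g).

Lemma laurent_mul_bilinear : bilinear_for *:%R *:%R laurent_mul.
Proof.
split=> [g a f f'|f a g g']; apply: laurentP => l.
  pose h : laurent := a *: f + f'.
  pose X := (lsupp h `|` (lsupp f `|` lsupp f'))%fset.
  rewrite coefD coefZ /= !(@conv_fset X).
  - rewrite scaler_sumr -big_split; apply: eq_bigr => i _ /=.
    exact: linearPl.
  - by apply/fsubsetP => i; rewrite !inE => ->; rewrite !orbT.
  - by apply/fsubsetP => i; rewrite !inE => ->; rewrite !orbT.
  - by apply/fsubsetP => i; rewrite !inE => ->.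
rewrite coefD coefZ /= !(conv_fset _ _ (fsubset_refl _)).
rewrite scaler_sumr -big_split; apply: eq_bigr => i _ /=.
exact: linearPr.
Qed.

HB.instance Definition _ := bilinear_isBilinear.Build k laurent laurent laurent
  *:%R *:%R laurent_mul laurent_mul_bilinear.

Definition laurent_algebra : algebra k := @Algebra k laurent laurent_mul.

Lemma tens_fin (u : A) (l : Zn) :
  (fun i => if i == l then u else 0) \in fin_supported.
Proof.
apply/fin_supportedP; apply: sub_finite_set (finite_set1 l) => i /=.
by case: (i =P l) => // _; rewrite eqxx.
Qed.

(* The pure tensor u (x) z^l. *)
Definition tens (u : A) (l : Zn) : laurent := Laurent (tens_fin u l).

Lemma tensE u l i : tens u l i = if i == l then u else 0. Proof. by []. Qed.

Lemma laurent_tens (f : laurent) : f = \sum_(l <- lsupp f) tens (f l) l.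
Proof.
apply: laurentP => i; rewrite coef_sum.
under eq_bigr do rewrite tensE.
have [fi|fi] := boolP (i \in lsupp f).
  rewrite (big_fsetD1 i) //= eqxx big_seq big1 ?addr0 // => j.
  by rewrite !inE eq_sym => /andP[/negPf ->].
have /eqP -> : f i == 0 by rewrite -[_ == _]negbK -mem_lsupp.
rewrite big_seq big1 // => j fj.
by case: (i =P j) => // ij; move: fi; rewrite ij fj.
Qed.

Lemma tens_mul u v l m :
  laurent_mul (tens u l) (tens v m) = tens (amul u v) (l + m).
Proof.
apply: laurentP => i /=; rewrite (@conv_fset [fset l]%fset); last first.
  apply/fsubsetP => j; rewrite mem_lsupp tensE inE.
  by case: (j == l) => //; rewrite eqxx.
rewrite big_seq_fset1 !tensE eqxx subr_eq addrC.
by case: ifP => // _; rewrite linear0r.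
Qed.

End Laurent.

Definition compatible_roots (k : fieldType) (zeta : nat -> k) : Prop :=
  (forall l, (0 < l)%N -> l.-primitive_root (zeta l)) /\
  (forall l m, (0 < l)%N -> (0 < m)%N -> zeta (m * l)%N ^+ m = zeta l).

Record multiloop_datum (k : fieldType) (A : algebra k) (n : nat) :=
  MultiloopDatum {
    period : 'I_n -> nat;
    period_gt0 : forall i, (0 < period i)%N;
    sigma : 'I_n -> automorphism A;
    sigma_comm : forall i j x, sigma i (sigma j x) = sigma j (sigma i x);
    sigma_period : forall i x, iter (period i) (sigma i) x = x }.

Section Multiloop.
Variables (k : fieldType) (zeta : nat -> k) (zetaP : compatible_roots zeta).
Variables (A : algebra k) (n : nat) (D : multiloop_datum A n).
Local Notation Zn := 'rV[int]_n.

Definition eigencomp (l : Zn) : set A :=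
  [set u | forall j, sigma D j u = zeta (period D j) ^ (l 0 j) *: u].

Definition multiloop_comp (l : Zn) : set (laurent A n) :=
  [set tens u l | u in eigencomp l].

Definition multiloop_set : set (laurent A n) := subspace_sum multiloop_comp.

Lemma zeta_neq0 j : zeta (period D j) != 0.
Proof.
have m0 := period_gt0 D j; apply/eqP => z0.
have /eqP := prim_expr_order (zetaP.1 _ m0).
by rewrite z0 expr0n eqn0Ngt m0 eq_sym oner_eq0.
Qed.

Lemma eigencomp0 l : eigencomp l 0.
Proof. by move=> j; rewrite linear0 scaler0. Qed.

Lemma eigencomp_lin l a u v :
  eigencomp l u -> eigencomp l v -> eigencomp l (a *: u + v).
Proof.
by move=> lu lv j; rewrite linearP lu lv scalerDr !scalerA mulrC.
Qed.

Lemma eigencomp_sum l (I : Type) (s : seq I) (F : I -> A) :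
  (forall i, eigencomp l (F i)) -> eigencomp l (\sum_(i <- s) F i).
Proof.
move=> lF; elim/big_rec: _ => [|i x _ lx]; first exact: eigencomp0.
by rewrite -[F i]scale1r; apply: eigencomp_lin.
Qed.

Lemma eigencomp_mul l m u v :
  eigencomp l u -> eigencomp m v -> eigencomp (l + m) (amul u v).
Proof.
move=> lu mv j; rewrite aut_mul lu mv linearZl linearZr /= scalerA mxE.
by rewrite expfzDr // zeta_neq0.
Qed.

Lemma multiloop_setP (f : laurent A n) :
  multiloop_set f <-> forall l, eigencomp l (f l).
Proof.
split=> [[s [F [cF ->]]] l|lf].
  rewrite coef_sum; apply: eigencomp_sum => i.
  have [u iu <-] := cF i; rewrite tensE; case: eqP => [->//|_].
  exact: eigencomp0.
exists (lsupp f), (fun l => tens (f l) l); split; last exact: laurent_tens.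
by move=> l; exists (f l).
Qed.

Definition multiloop_pred : {pred laurent A n} := [in multiloop_set].

Lemma multiloop_predP (f : laurent A n) :
  reflect (forall l, eigencomp l (f l)) (f \in multiloop_pred).
Proof.
apply: (iffP idP) => [/set_mem/multiloop_setP // | ?].
exact/mem_set/multiloop_setP.
Qed.

Lemma multiloop_submod : submod_closed multiloop_pred.
Proof.
split=> [|a f g /multiloop_predP lf /multiloop_predP lg].
  by apply/multiloop_predP => l; exact: eigencomp0.
by apply/multiloop_predP => l; exact: eigencomp_lin.
Qed.

HB.instance Definition _ := GRing.isSubmodClosed.Build k (laurent A n)
  multiloop_pred multiloop_submod.

Record multiloop_type := MultiloopType {
  mval :> laurent A n;
  mvalP : mval \in multiloop_pred }.

HB.instance Definition _ := [isSub for mval].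
HB.instance Definition _ := [Choice of multiloop_type by <:].
HB.instance Definition _ := [SubChoice_isSubLmodule of multiloop_type by <:].

Lemma mval_sum (I : Type) (s : seq I) (F : I -> multiloop_type) :
  mval (\sum_(i <- s) F i) = \sum_(i <- s) mval (F i).
Proof. exact: (raddf_sum \val). Qed.

Lemma multiloop_mul_closed (f g : multiloop_type) :
  laurent_mul f g \in multiloop_pred.
Proof.
apply/multiloop_predP => l /=; rewrite (conv_fset _ _ (fsubset_refl _)).
apply: eigencomp_sum => i; rewrite -[l in eigencomp l](subrK i) addrC.
by apply: eigencomp_mul; apply/multiloop_predP/mvalP.
Qed.

Definition multiloop_mul (f g : multiloop_type) : multiloop_type :=
  MultiloopType (multiloop_mul_closed f g).

Lemma multiloop_mul_bilinear : bilinear_for *:%R *:%R multiloop_mul.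
Proof.
by split=> [g a f f'|f a g g']; apply: val_inj; rewrite /= ?linearPl ?linearPr.
Qed.

HB.instance Definition _ := bilinear_isBilinear.Build k
  multiloop_type multiloop_type multiloop_type *:%R *:%R
  multiloop_mul multiloop_mul_bilinear.

Definition multiloop_algebra : algebra k :=
  @Algebra k multiloop_type multiloop_mul.

Definition multiloop_hcomp (l : Zn) : set multiloop_algebra :=
  [set f | multiloop_comp l (mval f)].

Lemma multiloop_hcomp_submod l : submod_closed [in multiloop_hcomp l].
Proof.
split=> [|a f g].
  rewrite inE /=; exists 0; first exact: eigencomp0.
  by apply: laurentP => i; rewrite tensE if_same.
rewrite !inE /= => -[u lu uf] [v lv vg].
exists (a *: u + v); first exact: eigencomp_lin.
apply: laurentP => i; rewrite tensE.
rewrite (_ : coef _ _ = a *: coef (mval f) i + coef (mval g) i) // -uf -vg.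
by rewrite !tensE; case: (i =P l) => // _; rewrite scaler0 addr0.
Qed.

Lemma multiloop_hcomp_sum : subspace_sum multiloop_hcomp = setT.
Proof.
rewrite -subTset => f _.
have tin l : tens (f l) l \in multiloop_pred.
  apply/multiloop_predP => i; rewrite tensE; case: eqP => [->|_].
    by apply/multiloop_predP/mvalP.
  exact: eigencomp0.
exists (lsupp f), (fun l => MultiloopType (tin l)); split=> [l|].
  by exists (f l) => //; apply/multiloop_predP/mvalP.
by apply: val_inj; rewrite raddf_sum /= -laurent_tens.
Qed.

Lemma multiloop_hcomp_independent : subspace_independent multiloop_hcomp.
Proof.
move=> s F us lF sF0 l ls; apply: val_inj; apply: laurentP => i.
have Fsupp m j : mval (F m) j = if j == m then mval (F m) j else 0.
  by have [u _ <-] := lF m; rewrite tensE; case: eqP.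
rewrite Fsupp; case: eqP => // ->.
have : mval (\sum_(m <- s) F m) l = 0 by rewrite sF0.
rewrite mval_sum coef_sum (bigD1_seq l) //= big1 ?addr0 // => m /negPf ml.
by rewrite Fsupp eq_sym ml.
Qed.

Lemma multiloop_hcomp_mul l m x y :
  multiloop_hcomp l x -> multiloop_hcomp m y ->
  multiloop_hcomp (l + m) (amul x y).
Proof.
move=> [u lu ux] [v mv vy]; exists (amul u v); first exact: eigencomp_mul.
by rewrite -tens_mul ux vy.
Qed.

Definition multiloop : gradedAlgebra k Zn :=
  @GradedAlgebra k Zn multiloop_algebra multiloop_hcomp multiloop_hcomp_submod
    multiloop_hcomp_sum multiloop_hcomp_independent multiloop_hcomp_mul.

End Multiloop.

Definition multiloop_realization (k : fieldType) (zeta : nat -> k)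
    (zetaP : compatible_roots zeta) (n : nat) (Lam : zmodType)
    (B : gradedAlgebra k Lam) (A : algebra k) : Prop :=
  exists D : multiloop_datum A n, isograded_isomorphic B (multiloop zetaP D).

Definition fd_simple_realization (k : fieldType) (zeta : nat -> k)
    (zetaP : compatible_roots zeta) (n : nat) (Lam : zmodType)
    (B : gradedAlgebra k Lam) : Prop :=
  exists (V : vectType k) (mulV : {bilinear V -> V -> V}),
    simple (@Algebra k V mulV) /\
    multiloop_realization zetaP n B (@Algebra k V mulV).

(* Main.v *)
Require Import Defs.
From HB Require Import structures.
From mathcomp Require Import all_boot all_order all_algebra.
From mathcomp Require Import finmap.
From mathcomp Require Import boolp classical_sets cardinality.

Set Implicit Arguments.
Unset Strict Implicit.
Unset Printing Implicit Defensive.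

Import Order.TTheory GRing.Theory Num.Theory.

Local Open Scope classical_set_scope.
Local Open Scope ring_scope.

(** The idea is to pass between B and its specializations.  Evaluating a
  multiloop algebra at z = 1 is a surjective homomorphism onto A which is
  injective on homogeneous components, and multiplication by z^h, for h a
  vector of multiples of the periods, is a homogeneous element of the centroid;
  graded simplicity, graded centrality and finite generation over the centroid
  are then deduced from the corresponding properties of A.

  Conversely, if B is graded-central-simple, the nonzero homogeneous elements of
  the centroid are invertible and unique up to a scalar.  Using the Smith normal
  form, one chooses coordinates nu on the lattice of degrees in which Gamma(B)
  is a product of ideals m_i Z, and units of the centroid indexed
  multiplicatively by Gamma(B).  Multiplying by these units moves each
  homogeneous component into the box 0 <= nu_i < m_i; this identifies the sum A
  of the components in the box with the quotient of B by the elements c x - x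
  for the chosen units c.  The algebra A is finite dimensional because B is fgc,
  it is simple because an element with the least number of components in a
  nonzero ideal is homogeneous, and the twists x |-> zeta_(m_i)^(nu_i) x of B
  induce the automorphisms of A.

  Finally, if B is fgc, its support is contained in finitely many cosets of
  Gamma(B), whence the last assertion. *)

(** * Linear maps given as plain functions, and the centroid *)

Section LinearProp.
Variables (k : pzRingType) (V W : lmodType k) (f : V -> W) (fL : linear f).

Let F : {linear V -> W} := HB.pack f (GRing.isLinear.Build k V W *:%R f fL).

Lemma lin0 : f 0 = 0. Proof. exact: (linear0 F). Qed.
Lemma linD x y : f (x + y) = f x + f y. Proof. exact: (linearD F). Qed.
Lemma linB x y : f (x - y) = f x - f y. Proof. exact: (linearB F). Qed.
Lemma linZ a x : f (a *: x) = a *: f x. Proof. exact: (linearZZ F). Qed.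
Lemma lin_sum (I : Type) (r : seq I) (P : pred I) (E : I -> V) :
  f (\sum_(i <- r | P i) E i) = \sum_(i <- r | P i) f (E i).
Proof. exact: (linear_sum F). Qed.

End LinearProp.

Lemma linear_sumf (k : comPzRingType) (V W : lmodType k) (I : Type) (r : seq I)
    (P : pred I) (E : I -> V -> W) :
  (forall i, linear (E i)) -> linear (fun x => \sum_(i <- r | P i) E i x).
Proof.
move=> EL a x y; rewrite scaler_sumr -big_split; apply: eq_bigr => i _.
exact: EL.
Qed.

Lemma linear_scalef (k : comPzRingType) (V W : lmodType k) (a : k) (f : V -> W) :
  linear f -> linear (fun x => a *: f x).
Proof. by move=> fL b x y; rewrite fL scalerDr !scalerA mulrC. Qed.

Lemma linear_compf (k : comPzRingType) (V W U : lmodType k) (g : W -> U)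
    (f : V -> W) :
  linear g -> linear f -> linear (g \o f).
Proof. by move=> gL fL b x y /=; rewrite fL gL. Qed.

Section AlgebraMul.
Variables (k : fieldType) (A : algebra k).

Lemma amul_linearl (y : A) : linear (fun x : A => amul x y).
Proof. by move=> a u v; rewrite linearPl. Qed.

Lemma amul_linearr (x : A) : linear (fun y : A => amul x y).
Proof. by move=> a u v; rewrite linearPr. Qed.

(** Commuting with the generating multiplications suffices: the operators that commute with a linear
    c are closed under linear combinations and composition. *)
Lemma centroidP (c : A -> A) :
  centroid c <-> [/\ linear c, forall x y, c (amul x y) = amul x (c y)
                  & forall x y, c (amul x y) = amul (c x) y].
Proof.
split=> [[cL cf]|[cL cr cl]].
  split=> // x y.
    by have := cf _ (MultLeft x); move/(congr1 (fun f => f y)).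
  by have := cf _ (MultRight y); move/(congr1 (fun f => f x)).
split=> // f; elim=> [|b|b|a g h _ gc _ hc|g h _ gc _ hc] //;
  apply/funext => x /=.
- by rewrite cr.
- by rewrite cl.
- have /= -> := congr1 (fun f => f x) (esym gc).
  have /= -> := congr1 (fun f => f x) (esym hc).
  exact: cL.
- have /= -> := congr1 (fun f => f (h x)) gc.
  by have /= -> := congr1 (fun f => f x) hc.
Qed.

End AlgebraMul.

(** * Graded algebras *)

Section Graded.
Variables (k : fieldType) (Lam : zmodType) (B : gradedAlgebra k Lam).
Implicit Types (l m : Lam) (x y : B).

Lemma hcomp0 l : hcomp B l 0.
Proof. by have [/set_mem ? _] := @hcomp_submod _ _ B l. Qed.

Lemma hcompP l a x y : hcomp B l x -> hcomp B l y -> hcomp B l (a *: x + y).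
Proof.
move=> /mem_set lx /mem_set ly.
by have [_ /(_ a x y lx ly)/set_mem] := @hcomp_submod _ _ B l.
Qed.

Lemma hcompD l x y : hcomp B l x -> hcomp B l y -> hcomp B l (x + y).
Proof. by move=> lx ly; rewrite -[x]scale1r; exact: hcompP. Qed.

Lemma hcompZ l a x : hcomp B l x -> hcomp B l (a *: x).
Proof. by move=> lx; rewrite -[a *: x]addr0; apply: hcompP => //; exact: hcomp0. Qed.

Lemma hcomp_sumr l (I : eqType) (r : seq I) (P : pred I) (E : I -> B) :
  (forall i, i \in r -> P i -> hcomp B l (E i)) ->
  hcomp B l (\sum_(i <- r | P i) E i).
Proof.
move=> lE; rewrite big_seq_cond.
elim/big_rec: _ => [|i x /andP[ri Pi] lx]; first exact: hcomp0.
by apply: hcompD lx; exact: lE.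
Qed.

(** A list given by [subspace_sum] may repeat a degree. Removing duplicates and multiplying [f l] by
    its multiplicity keeps the sum, and makes the family vanish off the list. *)
Lemma hdecomposition x : exists p : seq Lam * (Lam -> B),
  [/\ uniq p.1, forall l, hcomp B l (p.2 l), x = \sum_(l <- p.1) p.2 l
    & forall l, l \notin p.1 -> p.2 l = 0].
Proof.
have : subspace_sum (hcomp B) x by rewrite hcomp_sum.
move=> [s [f [lf ->]]].
exists (undup s, fun l => f l *+ count_mem l s) => /=.
split=> [|l||l]; first exact: undup_uniq.
- by rewrite -scaler_nat; exact: hcompZ.
- rewrite -big_undup_iterop_count; apply: eq_bigr => l _.
  by rewrite Monoid.iteropE iter_addr_0.
- by rewrite mem_undup => /count_memPn ->; rewrite mulr0n.
Qed.

(** A chosen list that contains the support of x; it may also contain degrees at which the component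
    of x is zero. *)
Definition gsupp x : seq Lam := (projT1 (cid (hdecomposition x))).1.
Definition gproj l x : B := (projT1 (cid (hdecomposition x))).2 l.

Lemma gsupp_uniq x : uniq (gsupp x).
Proof. by rewrite /gsupp; case: cid => /= p []. Qed.

Lemma gproj_hcomp l x : hcomp B l (gproj l x).
Proof. by rewrite /gproj; case: cid => /= p []. Qed.

Lemma gproj_out l x : l \notin gsupp x -> gproj l x = 0.
Proof. by rewrite /gproj /gsupp; case: cid => /= p [_ _ _]; exact. Qed.

Lemma gproj_sum x : x = \sum_(l <- gsupp x) gproj l x.
Proof. by rewrite /gproj /gsupp; case: cid => /= p []. Qed.

Lemma big_uniq_support (W : zmodType) (F : Lam -> W) (s t : seq Lam) :
  uniq s -> uniq t -> (forall l, l \notin s -> F l = 0) ->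
  (forall l, l \notin t -> F l = 0) ->
  \sum_(l <- s) F l = \sum_(l <- t) F l.
Proof.
move=> us ut Fs Ft.
suff H (r r' : seq Lam) : uniq r -> {subset r <= r'} -> uniq r' ->
    (forall l, l \notin r -> F l = 0) -> \sum_(l <- r') F l = \sum_(l <- r) F l.
  rewrite -(H s (undup (s ++ t))) ?undup_uniq //.
    rewrite (H t (undup (s ++ t))) ?undup_uniq // => l.
    by rewrite mem_undup mem_cat => ->; rewrite orbT.
  by move=> l; rewrite mem_undup mem_cat => ->.
move=> ur rr' ur' Fr; rewrite (bigID (mem r)) /= [X in _ + X]big1 // addr0.
rewrite -big_filter; apply: perm_big; apply: uniq_perm; rewrite ?filter_uniq //.
move=> l; rewrite mem_filter /=.
by case: (boolP (l \in r)) => // /rr' ->.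
Qed.

(** The difference of the two decompositions, written over the union of both lists, is a vanishing
    sum to which independence applies. *)
Lemma gproj_unique x (s : seq Lam) (g : Lam -> B) : uniq s ->
  (forall l, hcomp B l (g l)) -> (forall l, l \notin s -> g l = 0) ->
  x = \sum_(l <- s) g l -> forall l, gproj l x = g l.
Proof.
move=> us lg gs xE l.
pose t := undup (gsupp x ++ s).
have ut : uniq t by exact: undup_uniq.
have Hd m : hcomp B m (gproj m x - g m).
  rewrite addrC -scaleN1r; apply: hcompP => //; exact: gproj_hcomp.
have ts m : m \notin t -> m \notin gsupp x /\ m \notin s.
  by rewrite mem_undup mem_cat negb_or => /andP.
have H0 : \sum_(m <- t) (gproj m x - g m) = 0.
  rewrite sumrB -(@big_uniq_support _ (gproj^~ x) (gsupp x)) -?gproj_sum //.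
  - rewrite -(@big_uniq_support _ g s) // -?xE ?subrr // => m /ts[_ ?].
    exact: gs.
  - exact: gsupp_uniq.
  - by move=> m; exact: gproj_out.
  - by move=> m /ts[? _]; exact: gproj_out.
have [lt|/ts[lx ls]] := boolP (l \in t); last by rewrite gs // gproj_out.
apply/eqP; rewrite -subr_eq0; apply/eqP.
exact: hcomp_independent ut Hd H0 l lt.
Qed.

Lemma gproj_linear l : linear (gproj l).
Proof.
move=> a x y.
apply: (@gproj_unique _ (undup (gsupp x ++ gsupp y))
  (fun l => a *: gproj l x + gproj l y)) => [|m|m|].
- exact: undup_uniq.
- by apply: hcompP; exact: gproj_hcomp.
- rewrite mem_undup mem_cat negb_or => /andP[mx my].
  by rewrite !gproj_out // scaler0 addr0.
- rewrite big_split -scaler_sumr; congr (_ *: _ + _).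
    rewrite [LHS]gproj_sum; apply: big_uniq_support; rewrite ?gsupp_uniq ?undup_uniq //.
      by move=> m; exact: gproj_out.
    by move=> m; rewrite mem_undup mem_cat negb_or => /andP[? _]; exact: gproj_out.
  rewrite [LHS]gproj_sum; apply: big_uniq_support; rewrite ?gsupp_uniq ?undup_uniq //.
    by move=> m; exact: gproj_out.
  by move=> m; rewrite mem_undup mem_cat negb_or => /andP[_ ?]; exact: gproj_out.
Qed.

HB.instance Definition _ l :=
  GRing.isLinear.Build k B B *:%R (gproj l) (@gproj_linear l).

Lemma gproj_id l x : hcomp B l x -> forall m, gproj m x = if m == l then x else 0.
Proof.
move=> lx m; rewrite (@gproj_unique x [:: l] (fun m => if m == l then x else 0)) //.
- by move=> j; case: eqP => [->//|_]; exact: hcomp0.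
- by move=> j; rewrite inE => /negPf ->.
- by rewrite big_seq1 eqxx.
Qed.

Lemma gproj_idl l x : hcomp B l x -> gproj l x = x.
Proof. by move=> lx; rewrite (gproj_id lx) eqxx. Qed.

Lemma gproj_eq x y : (forall l, gproj l x = gproj l y) -> x = y.
Proof.
move=> xy; rewrite [x]gproj_sum [y]gproj_sum.
rewrite (eq_bigr (fun l => gproj l y)) => [|l _]; last exact: xy.
apply: big_uniq_support; rewrite ?gsupp_uniq // => l.
  by rewrite -xy; exact: gproj_out.
exact: gproj_out.
Qed.

Lemma hcomp_ind (P : B -> Prop) : (forall l x, hcomp B l x -> P x) ->
  (forall x y, P x -> P y -> P (x + y)) -> forall x, P x.
Proof.
move=> Ph PD x; rewrite [x]gproj_sum; elim/big_rec: _ => [|l y _ Py].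
  by apply: (Ph 0); exact: hcomp0.
by apply: PD => //; apply: (Ph l); exact: gproj_hcomp.
Qed.

Lemma hcomp_neq0 x : x != 0 -> exists l, gproj l x != 0.
Proof.
apply: contra_neqP => /forallNP H; apply: gproj_eq => l.
by rewrite linear0; apply/eqP/negPn/negP.
Qed.

(** Extends to B a family of maps of which each one matters, and has to be linear, only on its own
    component. This allows the [F l] to be defined by choice. *)
Definition glift (W : zmodType) (F : Lam -> B -> W) x : W :=
  \sum_(l <- gsupp x) F l (gproj l x).

Section Lift.
Variables (W : lmodType k) (F : Lam -> B -> W).
Hypothesis FL : forall l a x y, hcomp B l x -> hcomp B l y ->
  F l (a *: x + y) = a *: F l x + F l y.

Let F0 l : F l 0 = 0.
Proof.
have := FL 1 (hcomp0 l) (hcomp0 l); rewrite !scale1r addr0 => /eqP.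
by rewrite -subr_eq0 opprD addNKr oppr_eq0 => /eqP.
Qed.

Lemma glift_seq x s : uniq s -> (forall l, l \notin s -> gproj l x = 0) ->
  glift F x = \sum_(l <- s) F l (gproj l x).
Proof.
move=> us xs; apply: big_uniq_support; rewrite ?gsupp_uniq // => l.
  by move=> /gproj_out ->.
by move=> /xs ->.
Qed.

Lemma glift_hcomp l x : hcomp B l x -> glift F x = F l x.
Proof.
move=> lx; rewrite (@glift_seq _ [:: l]) ?big_seq1 ?gproj_idl // => m.
by rewrite inE (gproj_id lx) => /negPf ->.
Qed.

Lemma glift_linear : linear (glift F).
Proof.
move=> a x y; pose s := undup (gsupp x ++ gsupp y).
have sx l : l \notin s -> gproj l x = 0.
  by rewrite mem_undup mem_cat negb_or => /andP[? _]; exact: gproj_out.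
have sy l : l \notin s -> gproj l y = 0.
  by rewrite mem_undup mem_cat negb_or => /andP[_ ?]; exact: gproj_out.
rewrite !(@glift_seq _ s) ?undup_uniq // => [|l ls].
  rewrite scaler_sumr -big_split; apply: eq_bigr => l _ /=.
  by rewrite gproj_linear FL //; exact: gproj_hcomp.
by rewrite gproj_linear sx // sy // scaler0 addr0.
Qed.

End Lift.

Lemma linear_hcomp_eq (W : lmodType k) (f g : B -> W) : linear f -> linear g ->
  (forall l x, hcomp B l x -> f x = g x) -> f =1 g.
Proof.
move=> fL gL fg; apply: hcomp_ind => // x y fgx fgy.
by rewrite (linD fL) (linD gL) fgx fgy.
Qed.

Lemma gproj_amull m l x y : hcomp B l x ->
  gproj m (amul x y) = amul x (gproj (m - l) y).
Proof.
move=> lx; move: y; apply: linear_hcomp_eq.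
- exact: (linear_compf (@gproj_linear m) (@amul_linearr _ B x)).
- exact: (linear_compf (@amul_linearr _ B x) (@gproj_linear _)).
move=> j y jy; rewrite (gproj_id (hcomp_mul lx jy)) (gproj_id jy).
by rewrite subr_eq addrC; case: ifP => // _; rewrite linear0r.
Qed.

Lemma gproj_amulr m l x y : hcomp B l y ->
  gproj m (amul x y) = amul (gproj (m - l) x) y.
Proof.
move=> ly; move: x; apply: linear_hcomp_eq.
- exact: (linear_compf (@gproj_linear m) (@amul_linearl _ B y)).
- exact: (linear_compf (@amul_linearl _ B y) (@gproj_linear _)).
move=> j x jx; rewrite (gproj_id (hcomp_mul jx ly)) (gproj_id jx).
by rewrite subr_eq; case: ifP => // _; rewrite linear0l.
Qed.

Lemma centroid_hcompP (c : B -> B) : linear c ->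
  (forall l m x y, hcomp B l x -> hcomp B m y ->
     c (amul x y) = amul x (c y) /\ c (amul x y) = amul (c x) y) ->
  centroid c.
Proof.
move=> cL cm; apply/centroidP; split=> // x y.
  move: x; apply: linear_hcomp_eq.
  - exact: (linear_compf cL (@amul_linearl _ B y)).
  - exact: amul_linearl.
  move=> l x lx; move: y; apply: linear_hcomp_eq.
  - exact: (linear_compf cL (@amul_linearr _ B x)).
  - exact: (linear_compf (@amul_linearr _ B x) cL).
  - by move=> m y my; exact: (cm _ _ _ _ lx my).1.
move: x; apply: linear_hcomp_eq.
- exact: (linear_compf cL (@amul_linearl _ B y)).
- exact: (linear_compf (@amul_linearl _ B y) cL).
move=> l x lx; move: y; apply: linear_hcomp_eq.
- exact: (linear_compf cL (@amul_linearr _ B x)).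
- exact: amul_linearr.
- by move=> m y my; exact: (cm _ _ _ _ lx my).2.
Qed.

Lemma centroid_comp_gproj l (c : B -> B) : centroid_comp B l c ->
  forall m x, gproj (l + m) (c x) = c (gproj m x).
Proof.
move=> [/centroidP[cL _ _] cl] m; apply: linear_hcomp_eq.
- exact: (linear_compf (@gproj_linear _) cL).
- exact: (linear_compf cL (@gproj_linear _)).
move=> j x jx; rewrite (gproj_id (cl _ _ jx)) (gproj_id jx) (inj_eq (addrI _)).
by case: ifP => //; rewrite (lin0 cL).
Qed.

Lemma centroid_comp0 l : centroid_comp B l (fun=> 0).
Proof.
split; last by move=> m x _; exact: hcomp0.
apply/centroidP; split=> [a x y|x y|x y]; first by rewrite scaler0 addr0.
- by rewrite linear0r.
- by rewrite linear0l.
Qed.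

Lemma centroid_compP l a c d : centroid_comp B l c -> centroid_comp B l d ->
  centroid_comp B l (fun x => a *: c x + d x).
Proof.
move=> [/centroidP[cL cr cl] ch] [/centroidP[dL dr dl] dh]; split.
  apply/centroidP; split=> [b x y|x y|x y].
  - rewrite cL dL !scalerDr !scalerA [b * a]mulrC -!addrA; congr (_ + _).
    by rewrite addrCA.
  - by rewrite cr dr linearPr.
  - by rewrite cl dl linearPl.
by move=> m x mx; apply: hcompP; [exact: ch|exact: dh].
Qed.

Lemma centroid_comp_comp l m c d : centroid_comp B l c -> centroid_comp B m d ->
  centroid_comp B (l + m) (c \o d).
Proof.
move=> [/centroidP[cL cr cl] ch] [/centroidP[dL dr dl] dh]; split.
  apply/centroidP; split=> [|x y|x y] /=.
  - exact: linear_compf.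
  - by rewrite dr cr.
  - by rewrite dl cl.
by move=> j x jx; rewrite -addrA; apply: ch; exact: dh.
Qed.

Lemma centroid_comp_scale a : centroid_comp B 0 (fun x => a *: x).
Proof.
split; last by move=> m x mx; rewrite add0r; exact: hcompZ.
apply/centroidP; split=> [b x y|x y|x y].
- by rewrite scalerDr !scalerA mulrC.
- by rewrite linearZr.
- by rewrite linearZl.
Qed.

Lemma centroid_comp_id : centroid_comp B 0 id.
Proof.
have := centroid_comp_scale 1; congr (centroid_comp _ _ _).
by apply/funext => x; rewrite scale1r.
Qed.

Lemma GammaP l : Gamma B l <-> exists2 c, centroid_comp B l c & exists x, c x != 0.
Proof.
split=> [|[c lc [x cx]] E]; last first.
  by move: lc; rewrite E => c0; rewrite c0 eqxx in cx.
apply: contra_notP => H; apply/seteqP; split=> c /=; last first.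
  by move=> ->; exact: centroid_comp0.
move=> lc; apply/funext => x; apply/eqP/negPn/negP => cx.
by apply: H; exists c => //; exists x.
Qed.

(** The homogeneous component of degree l of an element c of the centroid. *)
Definition ccomp l (c : B -> B) : B -> B := glift (fun m x => gproj (l + m) (c x)).

Lemma ccompE l c : centroid c -> forall m x, hcomp B m x ->
  ccomp l c x = gproj (l + m) (c x).
Proof.
move=> /centroidP[cL _ _] m x mx; apply: glift_hcomp mx => j a u v _ _.
by rewrite cL gproj_linear.
Qed.

(** For x and y homogeneous of degrees i and j, project c(xy) = x c(y) = c(x) y onto degree l + i +
    j. *)
Lemma centroid_ccomp l c : centroid c -> centroid_comp B l (ccomp l c).
Proof.
move=> cC; have /centroidP[cL cr cl] := cC.
split=> [|m x mx]; last by rewrite (ccompE _ cC mx); exact: gproj_hcomp.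
apply: centroid_hcompP => [|i j x y ix jy].
  by apply: glift_linear => j a u v _ _; rewrite cL gproj_linear.
rewrite !(ccompE _ cC (hcomp_mul ix jy)) (ccompE _ cC ix) (ccompE _ cC jy).
split.
  by rewrite cr (gproj_amull _ _ ix) [i + j]addrC addrA addrK.
by rewrite cl (gproj_amulr _ _ jy) addrA addrK.
Qed.

End Graded.

(** * Graded-simple algebras and their centroid *)

Section GradedSimple.
Variables (k : fieldType) (Lam : zmodType) (B : gradedAlgebra k Lam).
Hypothesis hB : graded_simple B.
Implicit Types (l m : Lam) (x y : B).

(** Graded simplicity in the form used below: stability under homogeneous multipliers makes I an
    ideal, stability under the projections makes it graded. *)
Lemma graded_ideal_full (I : set B) : I 0 ->
  (forall a x y, I x -> I y -> I (a *: x + y)) ->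
  (forall l b x, hcomp B l b -> I x -> I (amul b x) /\ I (amul x b)) ->
  (forall l x, I x -> I (gproj l x)) ->
  (exists2 x, I x & x != 0) -> forall x, I x.
Proof.
move=> I0 IP IM Ig [z Iz z0].
have ID x y : I x -> I y -> I (x + y).
  by move=> Ix Iy; rewrite -[x]scale1r; exact: IP.
have IM' : forall b x, I x -> I (amul b x) /\ I (amul x b).
  apply: hcomp_ind => [l b lb x Ix|b c Ib Ic x Ix]; first exact: IM lb Ix.
  rewrite linearDl linearDr.
  by have [? ?] := Ib x Ix; have [? ?] := Ic x Ix; split; exact: ID.
have idI : ideal I.
  split=> //; split; first by rewrite inE.
  by move=> a x y; rewrite !inE => Ix Iy; exact: IP.
have [|E|E] := hB.2 I; last by move=> x; rewrite E.
- split=> //; apply/seteqP; split=> x /=.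
    move=> Ix; exists (gsupp x), (fun l => gproj l x); split; last exact: gproj_sum.
    by move=> l; split; [exact: Ig|exact: gproj_hcomp].
  move=> [s [f [If ->]]]; elim/big_rec: _ => // l y _ Iy.
  by apply: ID => //; have [] := If l.
- by move: Iz; rewrite E => /= z00; rewrite z00 eqxx in z0.
Qed.

(** The homogeneous elements of the multiplication algebra, with their degree. [HopZero] provides an
    operator in every degree, so that zero components are also values of operators. *)
Inductive hop : Lam -> (B -> B) -> Prop :=
| HopId : hop 0 id
| HopZero q : hop q (fun=> 0)
| HopLin q a f g : hop q f -> hop q g -> hop q (fun x => a *: f x + g x)
| HopLeft l b q f : hcomp B l b -> hop q f -> hop (l + q) (fun x => amul b (f x))
| HopRight l b q f : hcomp B l b -> hop q f -> hop (q + l) (fun x => amul (f x) b).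

Lemma hop_linear q f : hop q f -> linear f.
Proof.
elim=> {q f} [||q a f g _ fL _ gL|l b q f _ _ fL|l b q f _ _ fL] //.
- by move=> q a x y; rewrite scaler0 addr0.
- move=> c x y; rewrite fL gL !scalerDr !scalerA [a * c]mulrC -!addrA.
  by congr (_ + _); rewrite addrCA.
- exact: (linear_compf (@amul_linearr _ B b) fL).
- exact: (linear_compf (@amul_linearl _ B b) fL).
Qed.

Lemma hop_hcomp q f : hop q f ->
  forall l x, hcomp B l x -> hcomp B (q + l) (f x).
Proof.
elim=> {q f} [|q|q a f g _ fh _ gh|m b q f mb _ fh|m b q f mb _ fh] l x lx.
- by rewrite add0r.
- exact: hcomp0.
- by apply: hcompP; [exact: fh|exact: gh].
- by rewrite -addrA; apply: hcomp_mul mb (fh _ _ lx).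
- by rewrite addrAC; apply: hcomp_mul (fh _ _ lx) mb.
Qed.

Lemma hop_ideal q f : hop q f -> forall I : set B, ideal I ->
  forall x, I x -> I (f x).
Proof.
move=> + I [[I0 IP] IM].
elim=> {q f} [|q|q a f g _ fI _ gI|m b q f mb _ fI|m b q f mb _ fI] x Ix //.
- exact/set_mem.
- by apply/set_mem/IP; apply/mem_set; [exact: fI|exact: gI].
- by apply: (IM _ _ _).1; exact: fI.
- by apply: (IM _ _ _).2; exact: fI.
Qed.

(** The elements all of whose components are values at u of homogeneous operators form a graded
    ideal containing u. *)
Lemma hop_surj t u : hcomp B t u -> u != 0 ->
  forall l x, hcomp B l x -> exists2 f, hop (l - t) f & x = f u.
Proof.
move=> tu u0 l x lx.
pose I : set B := [set x | forall l, exists2 f, hop (l - t) f & gproj l x = f u].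
suff : I x by move=> /(_ l); rewrite (gproj_idl lx).
apply: graded_ideal_full => {l x lx} [l|a x y Ix Iy l|m b x mb Ix|m x Ix l|].
- by exists (fun=> 0); [exact: HopZero|rewrite linear0].
- have [f hf fE] := Ix l; have [g hg gE] := Iy l.
  by exists (fun x => a *: f x + g x); [exact: HopLin|rewrite gproj_linear fE gE].
- split=> l; have [f hf fE] := Ix (l - m).
    exists (fun x => amul b (f x)); last by rewrite (gproj_amull _ _ mb) fE.
    by have := HopLeft mb hf; rewrite addrA [m + _]addrC subrK.
  exists (fun x => amul (f x) b); last by rewrite (gproj_amulr _ _ mb) fE.
  by have := HopRight mb hf; rewrite addrAC subrK.
- rewrite (gproj_id (gproj_hcomp m x)); case: eqP => [->|_]; first exact: Ix.
  by exists (fun=> 0); first exact: HopZero.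
- exists u => // l; rewrite (gproj_id tu); case: eqP => [->|_].
    by exists id => //; rewrite subrr; exact: HopId.
  by exists (fun=> 0); first exact: HopZero.
Qed.

(** Schur's lemma: the kernel of c is a graded ideal. *)
Lemma centroid_comp_inj l c : centroid_comp B l c -> (exists x, c x != 0) ->
  injective c.
Proof.
move=> lc [x cx]; have [/centroidP[cL cr cl] ch] := lc.
suff H y : c y = 0 -> y = 0.
  move=> y z /eqP; rewrite -subr_eq0 -(linB cL) => /eqP/H/eqP.
  by rewrite subr_eq0 => /eqP.
apply: contraPeq => y0 cy; move: cx; apply/negP/negPn/eqP; move: x.
apply: (@graded_ideal_full [set x | c x = 0]) => /= [|a u v cu cv|m b u _ cu|m u cu|].
- exact: lin0.
- by rewrite cL cu cv scaler0 addr0.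
- by rewrite cr cl cu linear0l linear0r.
- by rewrite -(centroid_comp_gproj lc) cu linear0.
- by exists y.
Qed.

(** Schur's lemma again, with the image of c as the graded ideal. *)
Lemma centroid_comp_surj l c : centroid_comp B l c -> (exists x, c x != 0) ->
  forall y, exists x, c x = y.
Proof.
move=> lc [x cx]; have [/centroidP[cL cr cl] ch] := lc.
apply: (@graded_ideal_full [set y | exists x, c x = y]) => /=.
- by exists 0; exact: lin0.
- by move=> a x' y [u <-] [v <-]; exists (a *: u + v); rewrite cL.
- move=> m b y _ [u <-]; split; first by exists (amul b u); rewrite cr.
  by exists (amul u b); rewrite cl.
- move=> m y [u <-]; exists (gproj (m - l) u).
  by rewrite -(centroid_comp_gproj lc) addrC subrK.
- by exists (c x) => //; exists x.
Qed.

Lemma nontrivial : exists x : B, x != 0.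
Proof. by have [x [y xy]] := hB.1; exists (amul x y). Qed.

Lemma centroid_comp_inv l c : centroid_comp B l c -> (exists x, c x != 0) ->
  exists2 d, centroid_comp B (- l) d & cancel c d /\ cancel d c.
Proof.
move=> lc c0; have cI := centroid_comp_inj lc c0.
have [d cd] := choice (centroid_comp_surj lc c0).
have [/centroidP[cL cr cl] ch] := lc.
exists d; last by split=> [x|//]; apply: cI; rewrite cd.
split.
  apply/centroidP; split=> [a x y|x y|x y]; apply: cI.
  - by rewrite cL !cd.
  - by rewrite cr !cd.
  - by rewrite cl !cd.
move=> m x mx; suff -> : d x = gproj (- l + m) (d x) by exact: gproj_hcomp.
by apply: cI; rewrite -(centroid_comp_gproj lc) addNKr cd gproj_idl.
Qed.

(** On a product xy, both cd and dc give c(x) d(y). The set where they agree is therefore a graded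
    ideal that contains a nonzero product. *)
Lemma centroid_comp_comm l m c d : centroid_comp B l c -> centroid_comp B m d ->
  forall x, c (d x) = d (c x).
Proof.
move=> lc md; have [/centroidP[cL cr cl] ch] := lc.
have [/centroidP[dL dr dl] dh] := md.
have cdM x y : c (d (amul x y)) = d (c (amul x y)).
  by rewrite dr cl [c (amul x y)]cl dr.
apply: (@graded_ideal_full [set x | c (d x) = d (c x)]) => //=.
- by rewrite !(lin0 cL, lin0 dL).
- by move=> a x y; rewrite !(cL, dL) => -> ->.
- move=> j x cd; rewrite -(centroid_comp_gproj md) -(centroid_comp_gproj lc) cd.
  by rewrite addrCA (centroid_comp_gproj md) (centroid_comp_gproj lc).
- by have [x [y xy]] := hB.1; exists (amul x y).
Qed.

Lemma Gamma0 : Gamma B 0.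
Proof. by apply/GammaP; exists id; [exact: centroid_comp_id|exact: nontrivial]. Qed.

Lemma GammaN l : Gamma B l -> Gamma B (- l).
Proof.
move=> /GammaP[c lc c0]; apply/GammaP.
have [d ld [cd _]] := centroid_comp_inv lc c0; exists d => //.
by have [x x0] := nontrivial; exists (c x); rewrite cd.
Qed.

Lemma centroid_comp_comp_neq0 l m c d :
  centroid_comp B l c -> (exists x, c x != 0) ->
  centroid_comp B m d -> (exists x, d x != 0) -> exists x, (c \o d) x != 0.
Proof.
move=> lc c0 md [x dx]; exists x; apply: contra_neq dx => /=.
have [/centroidP[cL _ _] _] := lc; rewrite -{1}(lin0 cL).
exact: (centroid_comp_inj lc c0).
Qed.

Lemma GammaD l m : Gamma B l -> Gamma B m -> Gamma B (l + m).
Proof.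
move=> /GammaP[c lc c0] /GammaP[d md d0]; apply/GammaP; exists (c \o d).
  exact: centroid_comp_comp.
exact: centroid_comp_comp_neq0 lc c0 md d0.
Qed.

(** The composite of d with the inverse of c has degree 0, hence is a scalar. *)
Lemma centroid_comp_central l c d : graded_central B ->
  centroid_comp B l c -> (exists x, c x != 0) -> centroid_comp B l d ->
  exists a, forall x, d x = a *: c x.
Proof.
move=> cB lc c0 ld; have [e le [ce ec]] := centroid_comp_inv lc c0.
have := centroid_comp_comp le ld; rewrite addNr cB => -[a _ aE].
exists a => x; have [/centroidP[cL _ _] _] := lc.
by rewrite -[LHS]ec -(linZ cL) -[e (d x)]/((e \o d) x) -aE.
Qed.

Lemma gproj_centroid l c x : centroid c ->
  gproj l (c x) = \sum_(m <- gsupp x) ccomp (l - m) c (gproj m x).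
Proof.
move=> cC; have /centroidP[cL _ _] := cC.
rewrite {1}[x]gproj_sum (lin_sum cL) linear_sum; apply: eq_bigr => m _.
by rewrite (ccompE _ cC (gproj_hcomp _ _)) subrK.
Qed.

(** The list consists of the degrees of the components of the generators. If a nonzero x of degree l
    is the sum of the c_i(b_i), then for some i and m the component of c_i of degree l - m does not
    vanish on the component of b_i of degree m. *)
Lemma fgc_supp : fgc B -> exists s : seq Lam, forall l, supp B l ->
  exists2 m, m \in s & Gamma B (l - m).
Proof.
move=> [r [b bP]]; exists (flatten [seq gsupp (b i) | i : 'I_r]) => l lB.
have [x lx x0] : exists2 x, hcomp B l x & x != 0.
  apply: contra_notP lB => H; apply/seteqP; split=> x /=; last first.
    by move=> ->; exact: hcomp0.
  by move=> lx; apply/eqP/negPn/negP => x0; apply: H; exists x.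
have [c [cC xE]] := bP x; move: x0; rewrite -(gproj_idl lx) xE linear_sum.
apply: contra_neqP => H; apply: big1 => i _ /=; rewrite gproj_centroid // big_seq.
apply: big1 => m mi; apply/eqP/negPn/negP => nz; apply: H; exists m.
  by apply/flattenP; exists (gsupp (b i)) => //; apply/mapP; exists i; rewrite ?mem_enum.
apply/GammaP; exists (ccomp (l - m) (c i)); first exact: centroid_ccomp.
by exists (gproj m (b i)).
Qed.

End GradedSimple.

(** * The group of homogeneous units of the centroid *)

Section HomogeneousUnits.
Variables (k : fieldType) (Lam : zmodType) (B : gradedAlgebra k Lam).

(* The commutative group of nonzero homogeneous elements of the centroid,
   written additively. *)
Definition hunit (hB : graded_simple B) : Type :=
  {p : Lam * (B -> B) | centroid_comp B p.1 p.2 /\ exists x, p.2 x != 0}.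

Variable hB : graded_simple B.
Local Notation HU := (hunit hB).

Definition hdeg (u : HU) : Lam := (projT1 u).1.
Definition hfun (u : HU) : B -> B := (projT1 u).2.

Lemma hfun_centroid u : centroid_comp B (hdeg u) (hfun u).
Proof. by case: u => p []. Qed.

Lemma hfun_neq0 u : exists x, hfun u x != 0.
Proof. by case: u => p []. Qed.

Lemma hunitP u v : hdeg u = hdeg v -> hfun u = hfun v -> u = v.
Proof.
case: u v => [[l c] cP] [[m d] dP]; rewrite /hdeg /hfun /= => lm cd.
by subst m d; apply: eq_exist.
Qed.

Let hzero : HU.
Proof.
exists (0, id); split; first exact: centroid_comp_id.
exact: nontrivial.
Defined.

(** Addition is composition. The definition is transparent, so that [hdeg] and [hfun] of a sum
    compute. *)
Let hadd (u v : HU) : HU.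
Proof.
exists (hdeg u + hdeg v, hfun u \o hfun v); split.
  by apply: centroid_comp_comp; exact: hfun_centroid.
apply: (centroid_comp_comp_neq0 hB (hfun_centroid u) _ (hfun_centroid v));
  exact: hfun_neq0.
Defined.

Let hinv_ex (u : HU) : exists v : HU,
  hdeg v = - hdeg u /\ forall x, hfun v (hfun u x) = x.
Proof.
have [d ld [ud du]] := centroid_comp_inv hB (hfun_centroid u) (hfun_neq0 u).
have d0 : exists x, d x != 0.
  by have [x x0] := nontrivial hB; exists (hfun u x); rewrite ud.
by exists (exist _ (- hdeg u, d) (conj ld d0)).
Qed.

Let hopp (u : HU) : HU := projT1 (cid (hinv_ex u)).

HB.instance Definition _ := gen_eqMixin HU.
HB.instance Definition _ := gen_choiceMixin HU.

Let haddA : associative hadd.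
Proof. by move=> u v w; apply: hunitP => //; exact: addrA. Qed.

Let haddC : commutative hadd.
Proof.
move=> u v; apply: hunitP; first exact: addrC.
apply/funext => x.
exact: (centroid_comp_comm hB (hfun_centroid u) (hfun_centroid v)).
Qed.

Let hadd0 : left_id hzero hadd.
Proof. by move=> u; apply: hunitP => //; exact: add0r. Qed.

Let haddN : left_inverse hzero hopp hadd.
Proof.
move=> u; have [dE fE] := projT2 (cid (hinv_ex u)).
apply: hunitP; last by apply/funext => x; exact: fE.
by rewrite /hadd /hdeg /= -/(hdeg _) -/(hdeg u) dE addNr.
Qed.

HB.instance Definition _ :=
  GRing.isZmodule.Build HU haddA haddC hadd0 haddN.

Lemma hdeg_additive : {morph hdeg : u v / u - v}.
Proof.
have hD u v : hdeg (u + v) = hdeg u + hdeg v by [].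
by move=> u v; apply/eqP; rewrite eq_sym subr_eq -hD subrK.
Qed.

HB.instance Definition _ :=
  GRing.isZmodMorphism.Build HU Lam hdeg hdeg_additive.

Lemma hfunD u v x : hfun (u + v) x = hfun u (hfun v x).
Proof. by []. Qed.

Lemma hfunK (u : HU) : cancel (hfun u) (hfun (- u)).
Proof. by move=> x; rewrite -hfunD addNr. Qed.

End HomogeneousUnits.

(** * Evaluation of multiloop algebras *)

(** The hypothesis says p(c) x = 0. Write p = q (X - a) for a root a: either x is an eigenvector, or
    c x - a x is a nonzero vector killed by q(c), and q has smaller degree. The stability of P keeps
    the eigenvector inside P. *)
Lemma closed_eigenvector (k : closedFieldType) (V : lmodType k) (c : V -> V)
    (P : V -> Prop) :
  linear c -> (forall a x, P x -> P (c x - a *: x)) ->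
  forall N (p : {poly k}) x, (size p <= N)%N -> p != 0 -> P x -> x != 0 ->
    \sum_(i < N) p`_i *: iter i c x = 0 ->
  exists a y, [/\ P y, y != 0 & c y = a *: y].
Proof.
move=> cL cP; elim=> [|N IH] p x pN p0 Px x0 px.
  by move: pN; rewrite leqn0 size_poly_eq0 (negPf p0).
have [/size_poly1P[b b0 pE]|/closed_rootP[a]] := boolP (size p == 1).
  case/negP: x0; move: px; rewrite pE big_ord_recl big1 => [|i _].
    by rewrite coefC addr0 => /eqP; rewrite scaler_eq0 (negPf b0).
  by rewrite coefC scale0r.
move=> /factor_theorem[q pE].
have q0 : q != 0 by apply: contraNneq p0 => q0; rewrite pE q0 mul0r.
have qN : (size q <= N)%N.
  by move: pN; rewrite pE size_Mmonic ?monicXsubC // size_XsubC addn2.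
have [y0|y0] := eqVneq (c x - a *: x) 0.
  by exists a, x; split=> //; apply/eqP; rewrite -subr_eq0 y0.
apply: (IH q (c x - a *: x)) => //; first exact: cP.
rewrite -[RHS]px pE mulrBr.
under [RHS]eq_bigr do rewrite coefB scalerBl.
rewrite sumrB big_ord_recl coefMX scale0r add0r.
rewrite [X in _ = _ - X]big_ord_recr /= coefMC [q`_N]nth_default // mul0r scale0r addr0 -sumrB.
have itL i : linear (iter i c).
  by elim: i => [//|i iL]; apply: (linear_compf cL iL).
apply: eq_bigr => i _; rewrite (linB (itL i)) (linZ (itL i)) scalerBr scalerA.
by rewrite coefMX coefMC -iterSr.
Qed.

Lemma centroid_sum (k : fieldType) (A : algebra k) (I : Type) (r : seq I)
    (P : pred I) (c : I -> A -> A) :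
  (forall i, P i -> centroid (c i)) -> centroid (fun x => \sum_(i <- r | P i) c i x).
Proof.
(* [linear_sumf] asks for linearity of every summand, so the maps excluded by P are replaced by
   zero. *)
move=> cC; rewrite (_ : (fun x => _) =
    fun x => \sum_(i <- r | P i) (if P i then c i x else 0)); last first.
  by apply/funext => x; apply: eq_bigr => i Pi; rewrite Pi.
have cP i : [/\ linear (fun x => if P i then c i x else 0),
    forall x y, (if P i then c i (amul x y) else 0) =
      amul x (if P i then c i y else 0)
  & forall x y, (if P i then c i (amul x y) else 0) =
      amul (if P i then c i x else 0) y].
  have [Pi|_] := boolP (P i); first exact/centroidP/cC.
  by split=> [a x y|x y|x y]; rewrite ?scaler0 ?addr0 ?linear0l ?linear0r.
apply/centroidP; split=> [|x y|x y].
- by apply: linear_sumf => i; have [] := cP i.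
- by rewrite linear_sumr; apply: eq_bigr => i _; have [] := cP i.
- by rewrite linear_sumlz; apply: eq_bigr => i _; have [] := cP i.
Qed.

Section Evaluation.
Variables (k : closedFieldType) (Lam : zmodType) (B : gradedAlgebra k Lam).
Variables (V : vectType k) (mulV : {bilinear V -> V -> V}).
Local Notation A := (@Algebra k V mulV).
Hypothesis simpleA : simple A.

(* A multiloop algebra is evaluated at z = 1; H is the subgroup of degrees l
   such that z^l is central. *)
Variables (H : set Lam) (ev : B -> A) (pr : Lam -> A -> A).
Hypothesis H0 : H 0.
Hypothesis evL : linear ev.
Hypothesis evM : forall x y, ev (amul x y) = amul (ev x) (ev y).
Hypothesis ev_inj : forall l x, hcomp B l x -> ev x = 0 -> x = 0.
Hypothesis ev_surj : forall u, exists x, ev x = u.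
Hypothesis ev_shift : forall h l x, H h -> hcomp B l x ->
  exists2 y, hcomp B (h + l) y & ev y = ev x.
Hypothesis prL : forall l, linear (pr l).
(** [pr l] is the projection of A onto the common image of the components whose degrees are
    congruent to l modulo H. It separates what evaluation at z = 1 adds up. *)
Hypothesis pr_ev : forall l m x, hcomp B m x ->
  pr l (ev x) = if `[< H (l - m) >] then ev x else 0.

Let ev_eq l x y : hcomp B l x -> hcomp B l y -> ev x = ev y -> x = y.
Proof.
move=> lx ly xy; apply/eqP; rewrite -subr_eq0; apply/eqP.
apply: (ev_inj (l := l)); last by rewrite (linB evL) xy subrr.
by rewrite addrC -scaleN1r; exact: hcompP.
Qed.

(** Multiplication by z^h. Since [ev] is injective on each component, the element of degree h + l
    with the value of x is unique, and the choice is linear in x. *)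
Let shift h : B -> B :=
  glift (fun l x => xget 0 [set y | hcomp B (h + l) y /\ ev y = ev x]).

Let shift_get h l x : H h -> hcomp B l x ->
  let y := xget 0 [set y | hcomp B (h + l) y /\ ev y = ev x] in
  hcomp B (h + l) y /\ ev y = ev x.
Proof.
move=> Hh lx /=; have [y ly yx] := ev_shift Hh lx.
by apply: (@xgetPex _ 0 [set y | hcomp B (h + l) y /\ ev y = ev x]); exists y.
Qed.

Let shift_lin h : H h -> forall l a x y, hcomp B l x -> hcomp B l y ->
  let F l x := xget 0 [set y | hcomp B (h + l) y /\ ev y = ev x] in
  F l (a *: x + y) = a *: F l x + F l y.
Proof.
move=> Hh l a x y lx ly F.
have [? E] := shift_get Hh (hcompP a lx ly).
have [? Ex] := shift_get Hh lx; have [? Ey] := shift_get Hh ly.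
by apply: (@ev_eq (h + l)) => //; [exact: hcompP|rewrite evL E evL Ex Ey].
Qed.

Let shift_linear h : H h -> linear (shift h).
Proof. by move=> Hh; apply: glift_linear => *; exact: shift_lin. Qed.

Let shift_hcomp h l x : H h -> hcomp B l x ->
  hcomp B (h + l) (shift h x) /\ ev (shift h x) = ev x.
Proof.
move=> Hh lx; rewrite /shift (glift_hcomp _ lx); first exact: shift_get.
by move=> *; exact: shift_lin.
Qed.

Let ev_shiftE h x : H h -> ev (shift h x) = ev x.
Proof.
move=> Hh; move: x; apply: linear_hcomp_eq => //.
  exact: (linear_compf evL (shift_linear Hh)).
by move=> l x lx; have [] := shift_hcomp Hh lx.
Qed.

Let shift_centroid h : H h -> centroid_comp B h (shift h).
Proof.
move=> Hh; split=> [|m x mx]; last by have [] := shift_hcomp Hh mx.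
apply: centroid_hcompP => [|l m x y lx my]; first exact: shift_linear.
have [xh Ex] := shift_hcomp Hh lx; have [yh Ey] := shift_hcomp Hh my.
have [xyh Exy] := shift_hcomp Hh (hcomp_mul lx my).
split; apply: ev_eq xyh _ _; rewrite ?Exy ?evM ?Ex ?Ey //.
  by rewrite addrCA; exact: hcomp_mul.
by rewrite addrA; exact: hcomp_mul.
Qed.

(** The two-sided annihilator of A is an ideal, and it is not A because some product is nonzero. *)
Lemma ev_annihilator (u : A) : u != 0 ->
  exists b, amul b u != 0 \/ amul u b != 0.
Proof.
apply: contra_neqP => Hn.
have [|E|E] := simpleA.2 [set u : A | forall b, amul b u = 0 /\ amul u b = 0].
- split; first split.
  + by rewrite inE => b /=; rewrite linear0l linear0r.
  + move=> a x y; rewrite !inE => xA yA b /=.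
    have [bx xb] := xA b; have [by' yb] := yA b.
    by rewrite linearPr linearPl /= bx xb by' yb scaler0 addr0.
  + move=> b x xA; have [bx xb] := xA b.
    by rewrite bx xb; split=> c; rewrite linear0l linear0r.
- suff : [set u : A | forall b, amul b u = 0 /\ amul u b = 0] u by rewrite E.
  move=> b; split; apply/eqP/negPn/negP => nz; apply: Hn; exists b;
    by [left|right].
- have [x [y xy]] := simpleA.1; case/negP: xy; apply/eqP.
  have : [set: A] y by [].
  by rewrite -E => /(_ x)[].
Qed.

Lemma ev_graded_simple : graded_simple B.
Proof.
split.
  have [u [v uv]] := simpleA.1; have [x xu] := ev_surj u; have [y yv] := ev_surj v.
  exists x, y; apply: contraNneq uv => xy.
  by rewrite -xu -yv -evM xy (lin0 evL).
move=> I [[[/set_mem I0 IP'] IM] IE].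
have IP a x y : I x -> I y -> I (a *: x + y).
  by move=> Ix Iy; apply/set_mem/IP'; exact/mem_set.
have Isum (J : Type) (r : seq J) (P : pred J) (E : J -> B) :
    (forall j, P j -> I (E j)) -> I (\sum_(j <- r | P j) E j).
  move=> IEj; elim/big_rec: _ => // j y Pj Iy.
  by rewrite -[E j]scale1r; apply: IP => //; exact: IEj.
have Ig l x : I x -> I (gproj l x).
  rewrite {1}IE => -[s [f [fI ->]]]; rewrite linear_sum; apply: Isum => m _ /=.
  by have [fm mf] := fI m; rewrite (gproj_id mf); case: ifP.
have [->|[x Ix x0]] : I = [set 0] \/ exists2 x, I x & x != 0.
- have [|nI] := pselect (exists2 x, I x & x != 0); [by right|left].
  apply/seteqP; split=> x /= => [Ix|->//].
  by apply/eqP/negPn/negP => x0; apply: nI; exists x.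
- by left.
right; apply/seteqP; split=> // + _.
have [l xl0] := hcomp_neq0 x0.
(* B need not be unital, so stability of I under shifts is not immediate; [I2] collects the elements
   of I whose shifts stay in I. It contains the products of elements of I by elements of B, since a
   shift can be moved to the other factor. Hence [ev] maps [I2] onto a nonzero ideal of A. *)
pose I2 : set B := [set x | I x /\ forall h, H h -> I (shift h x)].
have idJ : ideal ([set ev x | x in I2] : set A).
  split; first split.
  - rewrite inE; exists 0; last exact: lin0.
    by split=> // h Hh; rewrite (lin0 (shift_linear Hh)).
  - move=> a u v; rewrite !inE => -[y [Iy Sy] <-] [z [Iz Sz] <-].
    exists (a *: y + z); last exact: evL.
    split=> [|h Hh]; first exact: IP.
    by rewrite (shift_linear Hh); apply: IP; [exact: Sy|exact: Sz].
  - move=> b u [y [Iy Sy] <-]; have [z <-] := ev_surj b; rewrite -!evM.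
    split; (eexists; last reflexivity).
      split=> [|h Hh]; first exact: (IM _ _ Iy).1.
      have [/centroidP[_ -> _] _] := shift_centroid Hh.
      exact: (IM _ _ (Sy _ Hh)).1.
    split=> [|h Hh]; first exact: (IM _ _ Iy).2.
    have [/centroidP[_ _ ->] _] := shift_centroid Hh.
    exact: (IM _ _ (Sy _ Hh)).2.
have JA : [set ev x | x in I2] = [set: A].
  have [E|//] := simpleA.2 _ idJ.
  have ux : ev (gproj l x) != 0.
    by apply: contra_neq xl0 => /(ev_inj (gproj_hcomp l x)).
  have [b] := ev_annihilator ux; have [z <-] := ev_surj b; rewrite -!evM.
  have Ixl := Ig l x Ix.
  suff [S1 S2] : I2 (amul z (gproj l x)) /\ I2 (amul (gproj l x) z).
    by case=> /negP []; apply/eqP; [have : [set 0] (ev (amul z (gproj l x)))|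
        have : [set 0] (ev (amul (gproj l x) z))] => //; rewrite -E;
      [exists (amul z (gproj l x))|exists (amul (gproj l x) z)].
  split; split=> [|h Hh].
  - exact: (IM _ _ Ixl).1.
  - have [/centroidP[_ _ ->] _] := shift_centroid Hh; exact: (IM _ _ Ixl).1.
  - exact: (IM _ _ Ixl).2.
  - have [/centroidP[_ -> _] _] := shift_centroid Hh; exact: (IM _ _ Ixl).2.
apply: hcomp_ind => [m y my|y z Iy Iz]; last by rewrite -[y]scale1r; exact: IP.
have : [set: A] (ev y) by []; rewrite -JA => -[z [Iz Sz] zy].
(* Apply [pr m] to [ev y = ev z]: only the components of z of degrees congruent to m survive.
   Shifted to degree m, they are components of shifts of z, hence lie in I. *)
have -> : y = \sum_(j <- gsupp z | `[< H (m - j) >]) shift (m - j) (gproj j z).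
  apply: (ev_eq (l := m)) => //.
    apply: hcomp_sumr => j _ /asboolP Hj.
    by have [+ _] := shift_hcomp Hj (gproj_hcomp j z); rewrite subrK.
  have -> : ev y = pr m (ev y).
    by rewrite (pr_ev _ my) subrr asboolT.
  rewrite -zy {1}[z]gproj_sum !(lin_sum evL) (lin_sum (prL m)) [RHS]big_mkcond.
  apply: eq_bigr => j _; rewrite (pr_ev _ (gproj_hcomp j z)).
  by case: asboolP => // Hj; rewrite ev_shiftE.
apply: Isum => j /asboolP Hj; have := Ig m _ (Sz _ Hj).
by rewrite -{1}[m](subrK j) (centroid_comp_gproj (shift_centroid Hj)).
Qed.

(** A component of B embeds in the finite dimensional A, so c has an eigenvector there, with
    eigenvalue a. Then c - a is homogeneous of degree 0 and not injective, hence zero. *)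
Lemma ev_graded_central : graded_central B.
Proof.
have hB := ev_graded_simple.
apply/seteqP; split=> [c|_ [a _ <-]]; last exact: centroid_comp_scale.
move=> c0 /=; have [x x0] := nontrivial hB; have [l xl0] := hcomp_neq0 x0.
have [/centroidP[cL cr cl] ch] := c0.
have itl i : hcomp B l (iter i c (gproj l x)).
  elim: i => [|i IH]; first exact: gproj_hcomp.
  by have := ch _ _ IH; rewrite add0r.
(* One vector more than the dimension of A: a linear relation among them is a polynomial in c that
   kills the component of x. *)
pose X := [tuple ev (iter (nat_of_ord i) c (gproj l x)) | i < (\dim {:V}).+1].
have /freeP : ~~ free X.
  rewrite /free size_tuple; apply/eqP => E.
  by have := dimvS (subvf <<X>>%VS); rewrite E ltnn.
move=> /existsNP[f /not_implyP[fX /existsNP[i0 /eqP fi0]]].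
pose p : {poly k} := \poly_(i < (\dim {:V}).+1) f (inord i).
have pf (i : 'I_(\dim {:V}).+1) : p`_i = f i by rewrite coef_poly ltn_ord inord_val.
have p0 : p != 0 by apply: contraNneq fi0 => p0; rewrite -pf p0 coef0.
have [a [y [ly y0 cy]]] : exists a y, [/\ hcomp B l y, y != 0 & c y = a *: y].
  apply: (@closed_eigenvector _ _ c (hcomp B l) cL _ _ p (gproj l x)
    (size_poly _ _)) => //.
  - move=> a y ly; rewrite addrC -scaleNr; apply: hcompP => //.
    by have := ch _ _ ly; rewrite add0r.
  - exact: gproj_hcomp.
  apply: (ev_inj (l := l)).
    by apply: hcomp_sumr => i _ _; exact: hcompZ.
  rewrite (lin_sum evL) -[RHS]fX; apply: eq_bigr => i _.
  by rewrite (linZ evL) pf (nth_map i) ?size_enum_ord // nth_ord_enum.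
exists a => //; apply/funext => z; apply/esym/eqP; rewrite -subr_eq0; apply/eqP.
have c0a : centroid_comp B 0 (fun z => - a *: z + c z).
  apply: centroid_compP c0; exact: centroid_comp_id.
rewrite addrC -scaleNr; apply: contraPP y0 => /eqP nz; apply/negP/negPn/eqP.
apply: (centroid_comp_inj hB c0a); first by exists z.
by rewrite cy scaleNr addNr (lin0 cL) scaler0 addr0.
Qed.

(** Lift a basis of A to B and take all the homogeneous components of the lifts. *)
Lemma ev_homogeneous_span : exists r (d : 'I_r -> Lam) (b : 'I_r -> B),
  (forall i, hcomp B (d i) (b i)) /\
  forall u, exists a : 'I_r -> k, u = \sum_(i < r) a i *: ev (b i).
Proof.
have /choice[y yP] (i : 'I_(\dim {:V})) := ev_surj (tnth (vbasis {:V}) i).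
pose s := flatten [seq [seq (l, gproj l (y i)) | l <- gsupp (y i)] | i : 'I_(\dim {:V})].
pose X := map_tuple (fun p => ev p.2) (in_tuple s).
exists (size s), (fun i => (tnth (in_tuple s) i).1), (fun i => (tnth (in_tuple s) i).2).
split=> [i|u].
  have /flattenP[_ /mapP[j _ ->] /mapP[l _ ->]] := mem_tnth i (in_tuple s).
  exact: gproj_hcomp.
have : u \in <<X>>%VS.
  apply: (subvP _ u (memvf u)); rewrite -(span_basis (vbasisP {:V})).
  apply/span_subvP => v /tnthP[i ->]; rewrite -yP [y i]gproj_sum (lin_sum evL).
  rewrite big_seq; apply: memv_suml => l ly; apply: memv_span.
  apply/mapP; exists (l, gproj l (y i)) => //.
  apply/flattenP; exists [seq (l, gproj l (y i)) | l <- gsupp (y i)].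
    by apply/mapP; exists i; rewrite ?mem_enum.
  by apply/mapP; exists l.
move=> /coord_span uE; exists (fun i => coord X i u); rewrite {1}uE.
by apply: eq_bigr => i _; rewrite -tnth_nth tnth_map.
Qed.

(** The homogeneous b_i whose values span A generate B: in an expression of the value of a component
    of degree l, [pr l] keeps the terms whose degrees are congruent to l modulo H, and shifts bring
    these b_i to degree l. *)
Lemma ev_fgc : fgc B.
Proof.
have [r [d [b [db span]]]] := ev_homogeneous_span.
exists r, b => x.
have /choice[a aP] l := span (ev (gproj l x)).
exists (fun i z =>
  \sum_(l <- gsupp x | `[< H (l - d i) >]) a l i *: shift (l - d i) z).
split=> [i|].
  apply: centroid_sum => l /asboolP Hl.
  have [lC _] := shift_centroid Hl.
  have /centroidP[cL cr cl] := lC; apply/centroidP; split=> [|u v|u v].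
  - exact: linear_scalef.
  - by rewrite cr linearZr.
  - by rewrite cl linearZl.
under eq_bigr do rewrite big_mkcond.
rewrite exchange_big {1}[x]gproj_sum; apply: eq_bigr => l _ /=.
rewrite -big_mkcond /=; apply: (ev_eq (gproj_hcomp l x)).
  apply: hcomp_sumr => i _ /asboolP Hi; apply: hcompZ.
  by have [+ _] := shift_hcomp Hi (db i); rewrite subrK.
have -> : ev (gproj l x) = pr l (ev (gproj l x)).
  by rewrite (pr_ev _ (gproj_hcomp l x)) subrr asboolT.
rewrite aP (lin_sum (prL l)) (lin_sum evL) [RHS]big_mkcond.
apply: eq_bigr => i _; rewrite (linZ (prL l)) (pr_ev _ (db i)).
by case: asboolP => [Hi|_]; rewrite ?scaler0 // (linZ evL) ev_shiftE.
Qed.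

Lemma ev_Gamma h : H h -> Gamma B h.
Proof.
move=> Hh; apply/GammaP; exists (shift h); first exact: shift_centroid.
have [x x0] := nontrivial ev_graded_simple; have [l xl0] := hcomp_neq0 x0.
exists (gproj l x); apply: contra_neq xl0 => sx.
by apply: ev_inj (gproj_hcomp l x) _; rewrite -(ev_shiftE _ Hh) sx (lin0 evL).
Qed.

End Evaluation.

(** * Roots of unity and projections onto joint eigenspaces *)

Lemma dvdzN d x : (d %| - x)%Z = (d %| x)%Z.
Proof. by rewrite !dvdzE abszN. Qed.

Lemma prim_exprz_eq1 (F : fieldType) (m : nat) (z : F) (c : int) :
  m.-primitive_root z -> (z ^ c == 1) = (m %| c)%Z.
Proof.
move=> zm; case: c => c.
  by rewrite -exprnP -(prim_order_dvd zm) dvdzE.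
by rewrite NegzE -exprnN invr_eq1 -(prim_order_dvd zm) dvdzE.
Qed.

Lemma sum_prim_exprz (F : fieldType) (m : nat) (z : F) (c : int) :
  m.-primitive_root z ->
  \sum_(b < m) z ^ (c * b%:Z) = if (m %| c)%Z then m%:R else 0.
Proof.
move=> zm; under eq_bigr do rewrite -exprz_exp.
rewrite -(prim_exprz_eq1 c zm); have [->|zc1] := eqVneq (z ^ c) 1.
  by under eq_bigr do rewrite exp1rz; rewrite sumr_const card_ord.
have /eqP := subrX1 (z ^ c) m.
rewrite exprnP exprz_exp mulrC -exprz_exp -exprnP (prim_expr_order zm) exp1rz.
by rewrite subrr eq_sym mulf_eq0 subr_eq0 (negPf zc1) => /eqP.
Qed.

Section MultiloopEvaluation.
Variables (k : closedFieldType) (char0 : [pchar k] =i pred0).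
Variables (zeta : nat -> k) (zetaP : compatible_roots zeta).
Variables (n : nat) (A : algebra k) (D : multiloop_datum A n).
Local Notation m := (period D).
Local Notation z j := (zeta (m j)).

Let zm j : (m j).-primitive_root (z j).
Proof. by apply: zetaP.1; exact: period_gt0. Qed.

Let m0 j : (m j)%:R != 0 :> k.
Proof. by rewrite (pcharf0P k).1 //  -lt0n period_gt0. Qed.

(** The discrete Fourier projection onto the eigenspace of [sigma D j] for the eigenvalue [z j ^ a].
    Characteristic 0 makes the order [m j] invertible. *)
Definition avg j (a : int) (u : A) : A :=
  (m j)%:R^-1 *: \sum_(b < m j) z j ^ (- a * b%:Z) *: iter b (sigma D j) u.

Let sigmaL j : linear (sigma D j). Proof. exact: linearP. Qed.

Let iter_linear j b : linear (iter b (sigma D j)).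
Proof. by elim: b => [//|b bL]; apply: (linear_compf (sigmaL j) bL). Qed.

Lemma avg_linear j a : linear (avg j a).
Proof.
apply: linear_scalef; apply: linear_sumf => b; apply: linear_scalef.
exact: iter_linear.
Qed.

Lemma iter_eigen j c u : sigma D j u = z j ^ c *: u ->
  forall b, iter b (sigma D j) u = z j ^ (c * b%:Z) *: u.
Proof.
move=> uc; elim=> [|b IH]; first by rewrite mulr0 expr0z scale1r.
rewrite iterS IH (linZ (sigmaL j)) uc scalerA -expfzDr ?zeta_neq0 //.
by rewrite -addn1 PoszD mulrDr mulr1.
Qed.

Lemma avg_eigen j a c u : sigma D j u = z j ^ c *: u ->
  avg j a u = if (m j %| a - c)%Z then u else 0.
Proof.
move=> uc; rewrite /avg.
under eq_bigr do rewrite (iter_eigen uc) scalerA -expfzDr ?zeta_neq0 // -mulrDl.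
rewrite -scaler_suml (sum_prim_exprz _ (zm j)) addrC -opprB dvdzN.
by case: ifP => _; rewrite ?scale0r ?scaler0 // scalerA mulVf ?scale1r.
Qed.

(** Orthogonality of characters: once the sums are exchanged, only the iterate b = 0 contributes. *)
Lemma sum_avg j u : u = \sum_(a < m j) avg j a%:Z u.
Proof.
rewrite -scaler_sumr exchange_big /=.
transitivity ((m j)%:R^-1 *: \sum_(b < m j)
    (if (b : nat) == 0%N then (m j)%:R else 0) *: iter b (sigma D j) u).
  have := period_gt0 D j; case: (m j) (m0 j) => // m' m'0 _.
  rewrite big_ord_recl big1 => [|b _]; last by rewrite scale0r.
  by rewrite addr0 scalerA mulVf // scale1r.
congr (_ *: _); apply: eq_bigr => b _; rewrite -scaler_suml; congr (_ *: _).
under eq_bigr do rewrite mulNr mulrC -mulNr.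
rewrite (sum_prim_exprz _ (zm j)) dvdzN dvdzE /=.
case: (nat_of_ord b) (ltn_ord b) => [|b' b'm]; first by rewrite dvdn0.
by rewrite gtnNdvd.
Qed.

Lemma sigma_avg j a u : sigma D j (avg j a u) = z j ^ a *: avg j a u.
Proof.
rewrite /avg (linZ (sigmaL j)) (lin_sum (sigmaL j)) scalerA mulrC -scalerA.
congr (_ *: _); rewrite scaler_sumr.
(* With the factor [z j ^ a] included, applying [sigma D j] to a term of the average raises the
   index of G by one; the sum is unchanged because G takes the same value at 0 and at [m j]. *)
pose G b := z j ^ (a - a * b%:Z) *: iter b (sigma D j) u.
transitivity (\sum_(b < m j) G b.+1).
  apply: eq_bigr => b _; rewrite (linZ (sigmaL j)) /G -iterS.
  by rewrite -addn1 PoszD mulrDr mulr1 opprD addrCA subrr addr0 mulNr.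
have GE : G (m j) = G 0%N.
  rewrite /G (_ : iter (m j) _ u = u); last exact: sigma_period.
  rewrite mulr0 subr0 expfzDr ?zeta_neq0 // -mulNr [- a * _]mulrC -exprz_exp -exprnP.
  by rewrite (prim_expr_order (zm j)) exp1rz mulr1.
transitivity (\sum_(b < m j) G b); last first.
  by apply: eq_bigr => b _; rewrite scalerA -expfzDr ?zeta_neq0 // mulNr.
have : \sum_(b < (m j).+1) G b = G 0%N + \sum_(b < m j) G b.+1.
  by rewrite big_ord_recl.
by rewrite big_ord_recr /= GE addrC => /addrI.
Qed.

Lemma sigma_avg_comm i j a c u : sigma D i u = z i ^ c *: u ->
  sigma D i (avg j a u) = z i ^ c *: avg j a u.
Proof.
move=> uc; rewrite /avg (linZ (sigmaL i)) (lin_sum (sigmaL i)).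
rewrite [RHS]scalerA [z i ^ c * _]mulrC -scalerA; congr (_ *: _).
rewrite scaler_sumr; apply: eq_bigr => b _.
rewrite (linZ (sigmaL i)) [RHS]scalerA [z i ^ c * _]mulrC -scalerA.
congr (_ *: _).
have -> : sigma D i (iter b (sigma D j) u) = iter b (sigma D j) (sigma D i u).
  by elim: (nat_of_ord b) => //= b' IH; rewrite sigma_comm IH.
by rewrite uc (linZ (iter_linear j b)).
Qed.

(** A is the sum of its joint eigenspaces: the automorphisms are diagonalized one after the other,
    and by commutation each average keeps the eigenvalues already fixed. *)
Lemma eigencomp_ind (P : A -> Prop) :
  (forall l u, eigencomp zeta D l u -> P u) -> P 0 ->
  (forall u v, P u -> P v -> P (u + v)) -> forall u, P u.
Proof.
move=> Pe P0 PD u.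
(* The eigenvalues of index at least t are already fixed: t = n imposes nothing, and t = 0 means a
   joint eigenvector. *)
suff H t (l : 'rV[int]_n) : (t <= n)%N -> forall u,
    (forall j : 'I_n, (t <= j)%N -> sigma D j u = z j ^ (l 0 j) *: u) -> P u.
  by apply: (H n 0 (leqnn n)) => j; rewrite leqNgt ltn_ord.
elim: t l => [|t IH] l tn {}u ul; first by apply: (Pe l) => j; exact: ul.
pose j := Ordinal tn; rewrite [u](sum_avg j); elim/big_rec: _ => // a v _ Pv.
apply: PD Pv.
apply: (IH (\row_i if i == j then a%:Z else l 0 i) (ltnW tn)) => i ti.
rewrite mxE; case: eqP => [->|/eqP ij]; first exact: sigma_avg.
apply: sigma_avg_comm; apply: ul; rewrite ltn_neqAle ti andbT.
by apply: contraNneq ij => ti'; apply/eqP/val_inj.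
Qed.

Definition eigenproj (l : 'rV[int]_n) : A -> A :=
  foldr (fun j f => avg j (l 0 j) \o f) id (enum 'I_n).

Lemma eigenproj_linear l : linear (eigenproj l).
Proof.
rewrite /eigenproj; elim: (enum 'I_n) => //= j s sL.
exact: (linear_compf (@avg_linear _ _) sL).
Qed.

Lemma eigenprojE l l' u : eigencomp zeta D l' u ->
  eigenproj l u = if `[< forall j, (m j %| (l - l')%R 0%R j)%Z >] then u else 0.
Proof.
move=> l'u; transitivity
    (if all (fun j => (m j %| (l - l')%R 0%R j)%Z) (enum 'I_n) then u else 0).
  rewrite /eigenproj; elim: (enum 'I_n) => //= j s ->.
  case: all; last by rewrite andbF (lin0 (@avg_linear _ _)).
  by rewrite (avg_eigen _ (l'u j)) !mxE andbT.
congr (if _ then _ else _); apply/allP/asboolP => [H j|H j _]; last exact: H.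
by apply: H; rewrite mem_enum.
Qed.

Lemma eigencomp_periodic (l h : 'rV[int]_n) u : (forall j, (m j %| h 0%R j)%Z) ->
  eigencomp zeta D l u -> eigencomp zeta D (h + l) u.
Proof.
move=> mh lu j; rewrite lu mxE expfzDr ?zeta_neq0 //.
by have /eqP -> : z j ^ h 0 j == 1; rewrite ?mul1r // (prim_exprz_eq1 _ (zm j)).
Qed.

End MultiloopEvaluation.

Lemma finite_int_box (Lam : zmodType) n (nu : {additive Lam -> 'rV[int]_n})
    (m : 'I_n -> nat) : injective nu -> (forall i, (0 < m i)%N) ->
  exists s : seq Lam, forall l, (forall i, 0 <= nu l 0 i < (m i)%:Z) -> l \in s.
Proof.
move=> nuI m0; pose M := (\sum_i m i)%N.
(* Points of the box outside the image of [nu] are sent to the default 0, which only lengthens the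
   list. *)
pose g (f : {ffun 'I_n -> 'I_M.+1}) : Lam :=
  xget 0 [set l | forall i, nu l 0 i = f i].
exists [seq g f | f : {ffun 'I_n -> 'I_M.+1}] => l lm.
pose f : {ffun 'I_n -> 'I_M.+1} := [ffun i => inord (absz (nu l 0 i))].
have fE i : nu l 0 i = f i.
  have /andP[l0 lmi] := lm i; rewrite ffunE inordK; first by rewrite gez0_abs.
  have miM : (m i <= M)%N by rewrite /M (bigD1 i) //= leq_addr.
  by rewrite ltnS; apply: leq_trans miM; rewrite -lez_nat gez0_abs // ltW.
apply/mapP; exists f; rewrite ?mem_enum //; apply: nuI; apply/rowP => i.
have := @xgetPex _ 0 [set l | forall i, nu l 0 i = f i]; rewrite -/(g f) => -> //.
by exists l.
Qed.

Lemma finite_cosets (Lam : zmodType) (G : set Lam) (s : seq Lam) :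
  G 0 -> (forall x y, G x -> G y -> G (x + y)) -> (forall x, G x -> G (- x)) ->
  (forall l, exists2 t, t \in s & G (l - t)) -> finite_index G.
Proof.
move=> G0 GD GN sG; rewrite /finite_index.
have : finite_set [set [set l + h | h in G] | l in [set` s]].
  by apply: finite_image; exact: finite_seq.
apply: sub_finite_set => _ [l _ <-]; have [t ts lt] := sG l.
exists t => //; apply/seteqP; split=> _ [h Gh <-].
  exists (h - (l - t)); first by apply: GD => //; exact: GN.
  by rewrite opprB addrCA subrKC addrC.
by exists (h + (l - t)); [exact: GD|rewrite addrCA subrKC addrC].
Qed.

(** * Necessity of the conditions *)

Section RealizationEvaluation.
Variables (k : closedFieldType) (char0 : [pchar k] =i pred0).
Variables (zeta : nat -> k) (zetaP : compatible_roots zeta) (n : nat).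
Variables (Lam : zmodType) (B : gradedAlgebra k Lam).
Variables (V : vectType k) (mulV : {bilinear V -> V -> V}).
Local Notation A := (@Algebra k V mulV).
Hypothesis simpleA : simple A.
Variable D : multiloop_datum A n.
Local Notation M := (multiloop zetaP D).
Variables (phi : {linear B -> M}) (nu : {additive Lam -> 'rV[int]_n}).
Hypotheses (phi_bij : bijective phi) (nu_bij : bijective nu).
Hypothesis phiM : forall x y : B, phi (amul x y) = amul (phi x) (phi y).
Hypothesis phi_hcomp : forall l, phi @` hcomp B l = hcomp M (nu l).

(** Evaluation at z = 1: an element of degree l is carried by [phi] to a single tensor, with
    exponent [nu l], whose coefficient is taken. *)
Let ev : B -> A := glift (fun l x => mval (phi x) (nu l)).

Let evF l a (x y : B) : hcomp B l x -> hcomp B l y ->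
  mval (phi (a *: x + y)) (nu l) =
  a *: (mval (phi x) (nu l) : A) + mval (phi y) (nu l).
Proof. by rewrite linearP. Qed.

Let evL : linear ev. Proof. exact: glift_linear evF. Qed.

Let phiE l x : hcomp B l x ->
  mval (phi x) = tens (ev x) (nu l) /\ eigencomp zeta D (nu l) (ev x).
Proof.
move=> lx; rewrite /ev (glift_hcomp evF lx).
have : (phi @` hcomp B l) (phi x) by exists x.
rewrite phi_hcomp => -[u lu ux].
by rewrite -ux tensE eqxx.
Qed.

Let phi_surj l u : eigencomp zeta D (nu l) u -> exists2 x, hcomp B l x & ev x = u.
Proof.
move=> lu.
have tl : tens u (nu l) \in multiloop_pred zeta D.
  apply/multiloop_predP => i; rewrite tensE; case: eqP => [->//|_].
  exact: eigencomp0.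
have : hcomp M (nu l) (MultiloopType tl) by exists u.
rewrite -phi_hcomp => -[x lx xE]; exists x => //.
by rewrite /ev (glift_hcomp evF lx) xE /= eqxx.
Qed.

Let evM x y : ev (amul x y) = amul (ev x) (ev y).
Proof.
move: x; apply: linear_hcomp_eq.
- exact: (linear_compf evL (@amul_linearl _ B y)).
- exact: (linear_compf (@amul_linearl _ A (ev y)) evL).
move=> l x lx; move: y; apply: linear_hcomp_eq.
- exact: (linear_compf evL (@amul_linearr _ B x)).
- exact: (linear_compf (@amul_linearr _ A (ev x)) evL).
move=> m y my; rewrite {1}/ev (glift_hcomp evF (hcomp_mul lx my)) phiM.
rewrite -[mval _]/(laurent_mul (mval (phi x)) (mval (phi y))).
have [-> _] := phiE lx; have [-> _] := phiE my.
by rewrite tens_mul tensE raddfD eqxx.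
Qed.

Let ev_inj l x : hcomp B l x -> ev x = 0 -> x = 0.
Proof.
move=> lx x0; have [xE _] := phiE lx; apply: (bij_inj phi_bij).
rewrite linear0; apply: val_inj; rewrite /= xE x0.
by apply: laurentP => i; rewrite tensE if_same.
Qed.

Let H : set Lam := [set l | forall j, (period D j %| nu l 0%R j)%Z].

Let H0 : H 0.
Proof. by move=> j; rewrite raddf0 mxE dvdz0. Qed.

Let ev_surj u : exists x, ev x = u.
Proof.
have [nu' nuK' nu'K] := nu_bij.
move: u; apply: (eigencomp_ind char0 zetaP (D := D)) => [l u lu||_ _ [x <-] [y <-]].
- by have := @phi_surj (nu' l) u; rewrite nu'K => /(_ lu)[x _ <-]; exists x.
- by exists 0; exact: lin0.
- by exists (x + y); rewrite (linD evL).
Qed.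

Let ev_shift h l x : H h -> hcomp B l x ->
  exists2 y, hcomp B (h + l) y & ev y = ev x.
Proof.
move=> Hh lx; apply: phi_surj; rewrite raddfD; have [_ ?] := phiE lx.
exact: eigencomp_periodic.
Qed.

Let pr_ev l m x : hcomp B m x ->
  eigenproj zeta D (nu l) (ev x) = if `[< H (l - m) >] then ev x else 0.
Proof.
move=> mx; have [_ xm] := phiE mx.
rewrite (eigenprojE char0 zetaP _ xm) -raddfB.
by congr (if _ then _ else _); apply: asbool_equiv_eq.
Qed.

Let prL l : linear (eigenproj zeta D (nu l)).
Proof. exact: eigenproj_linear. Qed.

Lemma realization_conditions :
  [/\ graded_central_simple B, fgc B & finite_index (Gamma B)].
Proof.
have Bs : graded_simple B.
  exact: (ev_graded_simple simpleA H0 evL evM ev_inj ev_surj ev_shift prL pr_ev).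
split; first split=> //.
- exact: (ev_graded_central simpleA H0 evL evM ev_inj ev_surj ev_shift prL pr_ev).
- exact: (ev_fgc H0 evL evM ev_inj ev_surj ev_shift prL pr_ev).
have [s sP] := finite_int_box (bij_inj nu_bij) (@period_gt0 _ _ _ D).
apply: (@finite_cosets _ _ s).
- exact: Gamma0.
- exact: GammaD.
- exact: GammaN.
move=> l; have [nu' nuK' nu'K] := nu_bij.
(* Reducing the coordinates modulo the periods gives a representative in the finite box. *)
exists (nu' (\row_i (nu l 0%R i %% period D i)%Z)).
  apply: sP => i; rewrite nu'K mxE modz_ge0 ?ltz_pmod //.
    by rewrite ltz_nat period_gt0.
  by rewrite gt_eqF // ltz_nat period_gt0.
apply: (ev_Gamma simpleA H0 evL evM ev_inj ev_surj ev_shift prL pr_ev) => j.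
by rewrite raddfB nu'K !mxE -eqz_mod_dvd modz_mod.
Qed.

End RealizationEvaluation.

(** * Subgroups of finite index in a lattice *)

Section FiniteIndex.
Variables (Lam : zmodType) (G : set Lam).
Hypothesis G0 : G 0.
Hypothesis GD : forall x y, G x -> G y -> G (x + y).
Hypothesis GN : forall x, G x -> G (- x).

Lemma subgroup_mulrz x z : G x -> G (x *~ z).
Proof.
move=> Gx; have Gn p : G (x *+ p).
  by elim: p => [|p IH]; rewrite ?mulr0n // mulrS; exact: GD.
by case: z => p; [exact: Gn|rewrite NegzE mulrNz; apply: GN; exact: Gn].
Qed.

Lemma subgroup_sum (I : Type) (r : seq I) (P : pred I) (E : I -> Lam) :
  (forall i, P i -> G (E i)) -> G (\sum_(i <- r | P i) E i).
Proof. by move=> GE; elim/big_rec: _ => // i x Pi Gx; apply: GD => //; exact: GE. Qed.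

(** Pigeonhole: two of the cosets of the multiples of x coincide, and the difference of these
    multiples lies in G. *)
Lemma finite_index_mulrn : finite_index G ->
  forall x, exists2 p : nat, (0 < p)%N & G (x *+ p).
Proof.
move=> Gf x; pose c (i : nat) := [set x *+ i + h | h in G].
have cG i j : (i < j)%N -> c i = c j -> G (x *+ (j - i)).
  move=> ij cij; have : c j (x *+ j + 0) by exists 0.
  by rewrite -cij addr0 => -[h Gh /(canRL (addKr _))E]; rewrite mulrnBr ?(ltnW ij) // addrC -E.
apply: contrapT => nx; apply: infinite_nat.
have cI : {in c @^-1` [set [set l + h | h in G] | l in [set: Lam]] &, injective c}.
  move=> i j _ _ cij; apply/eqP; case: ltngtP => // ij; case: nx.
    by exists (j - i)%N; rewrite ?subn_gt0 //; exact: cG.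
  by exists (i - j)%N; rewrite ?subn_gt0 //; apply: cG.
have := finite_preimage cI Gf; apply: sub_finite_set => i _ /=.
by exists (x *+ i).
Qed.

End FiniteIndex.

Section LatticeSmith.
Variables (n : nat) (G : set 'rV[int]_n).
Hypothesis G0 : G 0.
Hypothesis GD : forall x y, G x -> G y -> G (x + y).
Hypothesis GN : forall x, G x -> G (- x).

(** By division by N, G is generated by the multiples of N and by its finitely many vectors with
    coordinates between 0 and N - 1. Box vectors outside G are replaced by zero rows, so that the
    rows are indexed by the whole box. *)
Lemma lattice_generators N : (0 < N)%N -> (forall x : 'rV[int]_n, G (x *+ N)) ->
  exists r (M : 'M[int]_(r + n, n)), forall c, G c <-> exists w, c = w *m M.
Proof.
case: N => // N _ GN'; pose T := {ffun 'I_n -> 'I_N.+1}.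
pose vec (f : T) : 'rV[int]_n := \row_i (f i : nat)%:Z.
pose gen (f : T) : 'rV[int]_n := if `[< G (vec f) >] then vec f else 0.
have Ggen f : G (gen f) by rewrite /gen; case: asboolP.
pose M1 : 'M[int]_(#|T|, n) := \matrix_(i < #|T|) gen (enum_val i).
exists #|T|, (col_mx M1 (N.+1%:R)%:M) => c; split=> [Gc|[w ->]].
  pose f : T := [ffun i => inord (absz (c 0%R i %% N.+1)%Z)].
  have fE i : (f i : nat)%:Z = (c 0%R i %% N.+1)%Z.
    rewrite ffunE inordK ?gez0_abs ?modz_ge0 //.
    by rewrite -ltz_nat gez0_abs ?modz_ge0 // ltz_pmod.
  pose q : 'rV[int]_n := \row_i (c 0%R i %/ N.+1)%Z.
  have cE : c = vec f + q *+ N.+1.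
    apply/rowP => i; rewrite !mxE mulmxnE !mxE fE addrC -mulr_natr natz.
    exact: divz_eq.
  have Gf : G (vec f) by rewrite -[vec f](addrK (q *+ N.+1)) -cE; apply: GD => //; exact: GN.
  exists (row_mx (delta_mx 0 (enum_rank f)) q); rewrite mul_row_col mul_mx_scalar.
  by rewrite -rowE rowK enum_rankK /gen asboolT // {1}cE scaler_nat.
rewrite -[w]hsubmxK mul_row_col mul_mx_scalar scaler_nat; apply: GD => //.
rewrite mulmx_sum_row; apply: subgroup_sum => // i _.
by rewrite rowK -[_ 0 i]intz scaler_int; apply: subgroup_mulrz.
Qed.

(** If M = L D R is the Smith form of a matrix of generators, then in the coordinates c R^-1 the
    group G is the product of the ideals d_i Z. The generator matrix has at least n rows, so that
    each coordinate meets a diagonal entry. *)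
Lemma lattice_smith N : (0 < N)%N -> (forall x : 'rV[int]_n, G (x *+ N)) ->
  exists2 R : 'M[int]_n, R \in unitmx &
  exists2 m : 'I_n -> nat, (forall i, (0 < m i)%N) &
    forall c, G c <-> forall i, (m i %| (c *m R)%R 0%R i)%Z.
Proof.
move=> N0 GN'; have [r [M MP]] := lattice_generators N0 GN'.
have [L Lu [R Ru [d _ ME]]] := int_Smith_normal_form M.
pose Dm : 'M[int]_(r + n, n) := \matrix_(i, j) (d`_i *+ (i == j :> nat)).
have nle : (n <= r + n)%N by exact: leq_addl.
have wD (w : 'rV[int]_(r + n)) j : (w *m Dm) 0 j = w 0 (widen_ord nle j) * d`_j.
  rewrite mxE (bigD1 (widen_ord nle j)) //= big1 => [|i ij].
    by rewrite mxE eqxx addr0.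
  rewrite mxE; case: eqP => [E|_]; last by rewrite mulr0.
  by case/negP: ij; apply/eqP/val_inj.
have GR c : G c <-> forall i, (d`_i %| (c *m invmx R)%R 0%R i)%Z.
  rewrite MP ME -/Dm; split=> [[w ->] i|H].
    by rewrite !mulmxA mulmxK // wD dvdz_mull.
  (* The first n coordinates of w are the quotients by the d_i; the remaining ones meet zero rows of
     D and are set to 0. *)
  pose w : 'rV[int]_(r + n) := \row_i (if insub (i : nat) is Some j
    then ((c *m invmx R)%R 0%R (j : 'I_n) %/ d`_i)%Z else 0).
  exists (w *m invmx L); rewrite !mulmxA mulmxKV //.
  rewrite -[LHS](mulmxKV Ru); congr (_ *m _); apply/rowP => j.
  rewrite wD [w _ _]mxE (_ : insub _ = Some j) ?divzK ?H //; exact: (valK j).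
exists (invmx R); first by rewrite unitmx_inv.
exists (fun i => absz d`_i) => [i|c]; last first.
  rewrite GR; split=> H i; have := H i; by rewrite !dvdzE.
(* N times the i-th vector of the new basis lies in G, so d_i divides N and is nonzero. *)
have /GR/(_ i) := GN' (delta_mx 0 i *m R); rewrite absz_gt0.
rewrite -scaler_nat -scalemxAl mulmxK // !mxE !eqxx mulr1 natz.
by rewrite dvdzE; apply: contraTneq => ->; rewrite dvd0n -lt0n.
Qed.

End LatticeSmith.

Lemma subgroup_coordinates (Lam : zmodType) n (G : set Lam) :
  free_of_rank Lam n -> G 0 -> (forall x y, G x -> G y -> G (x + y)) ->
  (forall x, G x -> G (- x)) -> finite_index G ->
  exists (nu : {additive Lam -> 'rV[int]_n}) (m : 'I_n -> nat),
  [/\ bijective nu, forall i, (0 < m i)%N &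
      forall l, G l <-> forall i, (m i %| nu l 0%R i)%Z].
Proof.
move=> [e [g eK gK]] G0 GD GN Gf.
pose f (c : 'rV[int]_n) := \sum_(i < n) e i *~ c 0 i.
have fD c c' : f (c + c') = f c + f c'.
  by rewrite -big_split; apply: eq_bigr => i _; rewrite mxE mulrzDr.
have fN c : f (- c) = - f c.
  by rewrite -sumrN; apply: eq_bigr => i _; rewrite mxE mulrNz.
have gB x y : g (x - y) = g x - g y.
  by rewrite -[x]gK -[y]gK -/(f _) -/(f _) -fN -fD eK !eK.
have /choice[p pP] i : exists p, (0 < p)%N /\ G (e i *+ p).
  by have [p p0 Gp] := finite_index_mulrn G0 Gf (e i); exists p.
(* A common multiple of the [p i]: N times any lattice element lies in G. *)
pose N := (\prod_i p i)%N.
have N0 : (0 < N)%N by rewrite prodn_gt0 // => i; have [] := pP i.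
have GN' c : G (f (c *+ N)).
  apply: subgroup_sum => // i _; rewrite mulmxnE.
  rewrite (_ : c 0 i *+ N = (p i)%:Z * (c 0 i *+ (\prod_(j | j != i) p j)%N)); last first.
    by rewrite /N (bigD1 i) //= mulnC mulrnA -[LHS]mulr_natl natz.
  by rewrite mulrzA; apply: subgroup_mulrz => //; have [] := pP i.
have [|||R Ru [m m0 mP]] := @lattice_smith n [set c | G (f c)] _ _ _ N N0 GN'.
- by rewrite /= /f big1 // => i _; rewrite mxE mulr0z.
- by move=> x y /= ? ?; rewrite fD; exact: GD.
- by move=> x /= ?; rewrite fN; exact: GN.
pose nu x := g x *m R.
have nuB : {morph nu : x y / x - y} by move=> x y; rewrite /nu gB mulmxBl.
pose nuA : {additive Lam -> 'rV[int]_n} :=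
  HB.pack nu (GRing.isZmodMorphism.Build _ _ nu nuB).
exists nuA, m; split=> // [|l].
  exists (fun c => f (c *m invmx R)) => x /=; rewrite /nu /f ?mulmxK // ?gK //.
  by rewrite eK mulmxKV.
by rewrite -{1}[l]gK; exact: (mP (g l)).
Qed.

(** * Central images *)

Section InequivalentSupport.
Variables (k : fieldType) (Lam : zmodType) (B : gradedAlgebra k Lam).
Hypothesis hB : graded_simple B.

(** The exact support, as [gsupp] may list zero components; its size is the induction measure
    below. *)
Let nsupp (u : B) : seq Lam := [seq l <- gsupp u | gproj l u != 0].

Let mem_nsupp u l : (l \in nsupp u) = (gproj l u != 0).
Proof.
rewrite mem_filter; case: eqP => //= /eqP; apply: contra_neqT.
exact: gproj_out.
Qed.

Let nsupp_uniq u : uniq (nsupp u).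
Proof. by rewrite filter_uniq // gsupp_uniq. Qed.

Lemma gproj_hop q f : hop (B := B) q f ->
  forall l x, gproj (q + l) (f x) = f (gproj l x).
Proof.
move=> hf l; have fL := hop_linear hf; apply: linear_hcomp_eq.
- exact: (linear_compf (@gproj_linear _ _ B _) fL).
- exact: (linear_compf fL (@gproj_linear _ _ B _)).
move=> m x mx; rewrite (gproj_id (hop_hcomp hf mx)) (gproj_id mx).
by rewrite (inj_eq (addrI _)); case: ifP => // _; rewrite (lin0 fL).
Qed.

(** By [hop_surj] every homogeneous element is some f u1, and by hypothesis f u2 depends on f u1
    only. The map f u1 |-> f u2 commutes with multiplications, since these turn f into another
    operator, and it sends u1 to u2, which is nonzero. *)
Lemma hop_map_centroid t1 t2 (u1 u2 : B) : hcomp B t1 u1 -> hcomp B t2 u2 ->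
  u1 != 0 -> u2 != 0 ->
  (forall q f, hop (B := B) q f -> f u1 = 0 -> f u2 = 0) -> Gamma B (t2 - t1).
Proof.
move=> tu1 tu2 u10 u20 u12.
pose F l (x : B) := xget 0 [set y | exists2 f, hop (B := B) (l - t1) f & f u1 = x /\ f u2 = y].
have FE q f : hop (B := B) q f -> F (q + t1) (f u1) = f u2.
  move=> hf.
  have : [set y | exists2 g, hop (B := B) (q + t1 - t1) g & g u1 = f u1 /\ g u2 = y]
      (F (q + t1) (f u1)).
    by apply: xgetPex; exists (f u2), f => //; rewrite addrK.
  case=> g; rewrite addrK => hg [gf1 <-].
  have := u12 _ _ (HopLin (-1) hf hg); rewrite gf1 scaleN1r addNr => /(_ erefl).
  by rewrite scaleN1r addrC => /subr0_eq.
have FL l a x y : hcomp B l x -> hcomp B l y -> F l (a *: x + y) = a *: F l x + F l y.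
  move=> lx ly; have [f hf ->] := hop_surj hB tu1 u10 lx.
  have [g hg ->] := hop_surj hB tu1 u10 ly.
  have := FE _ _ (HopLin a hf hg); rewrite subrK => ->.
  by have := FE _ _ hf; have := FE _ _ hg; rewrite !subrK => -> ->.
have cE l x : hcomp B l x -> glift F x = F l x by exact: glift_hcomp.
have FM l i b x : hcomp B l x -> hcomp B i b ->
    F (i + l) (amul b x) = amul b (F l x) /\ F (l + i) (amul x b) = amul (F l x) b.
  move=> lx ib; have [f hf ->] := hop_surj hB tu1 u10 lx.
  have := FE _ _ hf; rewrite subrK => ->; split.
    by have := FE _ _ (HopLeft ib hf); rewrite -addrA subrK.
  by have := FE _ _ (HopRight ib hf); rewrite addrAC subrK.
apply/GammaP; exists (glift F).
  split=> [|l x lx].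
    apply: centroid_hcompP => [|l m x y lx my]; first exact: glift_linear.
    rewrite (cE _ _ (hcomp_mul lx my)) (cE _ _ lx) (cE _ _ my).
    by split; [exact: (FM _ _ _ _ my lx).1|exact: (FM _ _ _ _ lx my).2].
  rewrite (cE _ _ lx); have [f hf ->] := hop_surj hB tu1 u10 lx.
  have := FE _ _ hf; rewrite subrK => ->.
  by have := hop_hcomp hf tu2; rewrite addrC addrA addrAC.
exists u1; rewrite (cE _ _ tu1).
by have := FE _ _ (HopId B); rewrite add0r => ->.
Qed.

(* An element of the ideal with fewest homogeneous components is homogeneous:
   otherwise two of its components u1, u2 have the same annihilators, and
   f u1 |-> f u2 is an element of the centroid of degree t2 - t1. *)
Lemma inequivalent_ideal_full (I : set B) (u : B) : ideal I -> I u -> u != 0 ->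
  (forall l m, gproj l u != 0 -> gproj m u != 0 -> Gamma B (l - m) -> l = m) ->
  forall x, I x.
Proof.
move=> idI; have [[/set_mem I0 IP'] IM] := idI.
have [N] := ubnP (size (nsupp u)); elim: N u => // N IH u uN Iu u0 uG.
have [t1 t1u] := hcomp_neq0 u0.
have [[t2 t2u t12]|only] := pselect (exists2 t, gproj t u != 0 & t <> t1); last first.
  have tu : hcomp B t1 u.
    rewrite [u]gproj_sum; apply: hcomp_sumr => l _ _.
    have [->|lt1] := eqVneq l t1; first exact: gproj_hcomp.
    have [->|nz] := eqVneq (gproj l u) 0; first exact: hcomp0.
    by case: only; exists l => //; exact/eqP.
  apply: hcomp_ind => [l x lx|x y Ix Iy].
    by have [f hf ->] := hop_surj hB tu u0 lx; exact: (hop_ideal hf).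
  by rewrite -[x]scale1r; apply/set_mem/IP'; exact/mem_set.
have [all12|] := pselect
    (forall q f, hop (B := B) q f -> f (gproj t1 u) = 0 -> f (gproj t2 u) = 0).
  case: t12; apply: uG => //.
  exact: (hop_map_centroid (gproj_hcomp t1 u) (gproj_hcomp t2 u)).
(* Otherwise some f kills the component at t1 but not the one at t2. Then f u is nonzero and has
   fewer components; its degrees are translates by q of degrees of u, so they remain
   inequivalent. *)
move=> /existsNP[q /existsNP[f /not_implyP[hf /not_implyP[f1 /eqP f2]]]].
have fG t : gproj t (f u) = f (gproj (t - q) u).
  by rewrite -(gproj_hop hf) addrC subrK.
have fG0 t : gproj t (f u) != 0 -> gproj (t - q) u != 0.
  by rewrite fG; apply: contra_neq => ->; rewrite (lin0 (hop_linear hf)).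
apply: (IH (f u)) => [||| l m fl fm G].
- rewrite ltnS in uN; apply: leq_trans uN.
  have t1s : t1 \in nsupp u by rewrite mem_nsupp.
  rewrite (perm_size (perm_to_rem t1s)) /= ltnS -(size_map (fun t => t - q)).
  apply: uniq_leq_size; first by rewrite map_inj_uniq // => x y /addIr.
  move=> _ /mapP[t tf ->]; rewrite mem_nsupp in tf.
  rewrite mem_rem_uniq // inE mem_nsupp fG0 // andbT.
  by apply: contra_neq tf => tE; rewrite fG tE.
- exact: (hop_ideal hf).
- apply: contra_neq f2 => fu0.
  by rewrite -(gproj_hop hf) fu0 linear0.
- apply: (addIr (- q)); apply: uG; [exact: fG0|exact: fG0|].
  by rewrite opprB addrA subrK.
Qed.

End InequivalentSupport.

(** * Extracting a basis from a finite spanning list *)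

Section FiniteBasis.
Variables (k : fieldType) (W : lmodType k).

Definition lspan (s : seq W) : set W :=
  [set x | exists a : nat -> k, x = \sum_(i < size s) a i *: s`_i].

Lemma lspanP s a x y : lspan s x -> lspan s y -> lspan s (a *: x + y).
Proof.
move=> [b ->] [c ->]; exists (fun i => a * b i + c i).
rewrite scaler_sumr -big_split; apply: eq_bigr => i _.
by rewrite scalerDl scalerA.
Qed.

Lemma lspan0 s : lspan s 0.
Proof. by exists (fun=> 0); rewrite big1 // => i _; rewrite scale0r. Qed.

Lemma lspanZ s a x : lspan s x -> lspan s (a *: x).
Proof. by move=> sx; rewrite -[_ *: _]addr0; apply: lspanP => //; exact: lspan0. Qed.

Lemma lspan_sum s (I : eqType) (r : seq I) (P : pred I) (E : I -> W) :
  (forall i, i \in r -> P i -> lspan s (E i)) -> lspan s (\sum_(i <- r | P i) E i).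
Proof.
move=> sE; rewrite big_seq_cond; elim/big_rec: _ => [|i x /andP[ri Pi] sx].
  exact: lspan0.
by rewrite -[E i]scale1r; apply: lspanP => //; exact: sE.
Qed.

Lemma lspan_mem s x : x \in s -> lspan s x.
Proof.
move=> xs; exists (fun i => (i == index x s)%:R).
have xi : (index x s < size s)%N by rewrite index_mem.
rewrite (bigD1 (Ordinal xi)) //= eqxx scale1r nth_index // big1 ?addr0 //.
by move=> i /negPf; rewrite -val_eqE /= => ->; rewrite scale0r.
Qed.

Lemma finite_basis (P : set W) (s : seq W) : (forall v, v \in s -> P v) ->
  P `<=` lspan s ->
  exists r (e : 'I_r -> W), [/\ forall i, P (e i),
    forall x, P x -> exists a : 'rV[k]_r, x = \sum_(i < r) a 0 i *: e i &
    forall a : 'rV[k]_r, \sum_(i < r) a 0 i *: e i = 0 -> a = 0].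
Proof.
have [N] := ubnP (size s); elim: N s => // N IH s sN sP Ps.
have [H|] := pselect (forall a : 'rV[k]_(size s),
    \sum_(i < size s) a 0 i *: s`_i = 0 -> a = 0).
  exists (size s), (fun i => s`_i); split=> // [i|x /Ps[a ->]].
    by apply: sP; exact: mem_nth.
  by exists (\row_i a i); apply: eq_bigr => i _; rewrite mxE.
move=> /existsNP[a /not_implyP[a0 /eqP/rV0Pn[j aj]]].
pose t := take j s ++ drop j.+1 s.
have st : {subset t <= s}.
  by move=> x; rewrite mem_cat => /orP[/mem_take|/mem_drop].
have ti (i : 'I_(size s)) : i != j -> s`_i \in t.
  move=> ij; rewrite mem_cat; have [lij|lji|/val_inj E] := ltngtP i j.
  - by rewrite -(nth_take 0 lij) mem_nth // size_takel // ltnW.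
  - apply/orP; right; rewrite -[i : nat](subnKC lji) -nth_drop mem_nth //.
    by rewrite size_drop ltn_sub2r // (leq_trans _ (ltn_ord i)).
  - by rewrite E eqxx in ij.
have tj : lspan t s`_j.
  have -> : s`_j = \sum_(i < size s | i != j) (- (a 0 j)^-1 * a 0 i) *: s`_i.
    under eq_bigr do rewrite -scalerA.
    rewrite -scaler_sumr; move: a0; rewrite (bigD1 j) //= => /eqP.
    rewrite addr_eq0 => /eqP/(congr1 (fun z => (a 0 j)^-1 *: z)).
    by rewrite scalerA mulVf // scale1r scaleNr scalerN.
  by apply: lspan_sum => i _ ij; apply: lspanZ; apply: lspan_mem; exact: ti.
apply: (IH t) => [|v /st/sP//|x /Ps[b ->]].
  rewrite ltnS in sN; apply: leq_trans sN.
  rewrite size_cat size_takel ?size_drop; last exact: ltnW.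
  by rewrite -addnS -subSn // subSS subnKC // ltnW.
apply: lspan_sum => i _ _; apply: lspanZ.
by have [->//|ij] := eqVneq i j; apply: lspan_mem; exact: ti.
Qed.

End FiniteBasis.

(** * Normalizing degrees by units of the centroid *)

Section Normalization.
Variables (k : fieldType) (Lam : zmodType) (B : gradedAlgebra k Lam).
Hypotheses (hC : graded_central B) (hB : graded_simple B) (hF : fgc B).
Variables (n : nat) (nu : {additive Lam -> 'rV[int]_n}) (m : 'I_n -> nat).
Hypotheses (nu_bij : bijective nu) (m0 : forall i, (0 < m i)%N).
Hypothesis GammaE : forall l, Gamma B l <-> forall i, (m i %| nu l 0%R i)%Z.
Local Notation HU := (hunit hB).

Let mz0 i : (m i)%:Z != 0. Proof. by rewrite -lt0n. Qed.

(** Units are chosen only for the generators m_i e_i of Gamma, in the coordinates [nu]. Since units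
    form a commutative group, the choice extends additively, which makes it multiplicative in the
    centroid. *)
Lemma hunit_lattice : exists U : {additive 'rV[int]_n -> HU},
  forall q i, nu (hdeg (U q)) 0 i = (m i)%:Z * q 0 i.
Proof.
have [nu' nuK' nu'K] := nu_bij.
have /choice[u uP] i : exists u : HU, hdeg u = nu' ((m i)%:Z *: delta_mx 0 i).
  pose g := nu' ((m i)%:Z *: delta_mx 0 i).
  have /GammaE/GammaP[c cl c0] : forall j, (m j %| nu g 0%R j)%Z.
    move=> j; rewrite nu'K !mxE eqxx /=.
    by case: eqP => [->|_]; rewrite ?mulr1 ?mulr0 ?dvdz0.
  by exists (exist _ (_, c) (conj cl c0)).
pose U (q : 'rV[int]_n) : HU := \sum_i u i *~ q 0 i.
have UB : {morph U : x y / x - y}.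
  by move=> x y; rewrite -sumrB; apply: eq_bigr => i _; rewrite !mxE mulrzBr.
pose UA : {additive 'rV[int]_n -> HU} :=
  HB.pack U (GRing.isZmodMorphism.Build _ _ U UB).
exists UA => q i /=.
rewrite /U !raddf_sum summxE (bigD1 i) //= big1 => [|j ji].
  rewrite !raddfMz /= uP nu'K addr0 -scaler_int !mxE !eqxx mulr1 mulrC.
  by rewrite intz.
rewrite !raddfMz /= uP nu'K -scaler_int !mxE eqxx [i == j]eq_sym (negPf ji) /=.
by rewrite !mulr0.
Qed.

Variable U : {additive 'rV[int]_n -> HU}.
Hypothesis UE : forall q i, nu (hdeg (U q)) 0 i = (m i)%:Z * q 0 i.

Definition quot l : 'rV[int]_n := \row_i (nu l 0%R i %/ m i)%Z.
(** The representative of the coset of l modulo Gamma in the box 0 <= nu_i < m_i. *)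
Definition rep l : Lam := hdeg (U (- quot l)) + l.

(* The projection of B onto the sum of its components of degrees
   0 <= nu l < m, obtained by multiplication by units of the centroid. *)
Definition normalize : B -> B := glift (fun l x => hfun (U (- quot l)) x).

Let hfunL (u : HU) : linear (hfun u).
Proof. by have [/centroidP[? _ _] _] := hfun_centroid u. Qed.

Lemma normalize_linear : linear normalize.
Proof. by apply: glift_linear => *; exact: hfunL. Qed.

Lemma normalizeE l x : hcomp B l x -> normalize x = hfun (U (- quot l)) x.
Proof. by move=> lx; apply: glift_hcomp lx => *; exact: hfunL. Qed.

Lemma quotD q l : quot (hdeg (U q) + l) = q + quot l.
Proof.
by apply/rowP => i; rewrite !mxE raddfD mxE UE mulrC divzMDl.
Qed.

Lemma nu_rep l i : nu (rep l) 0 i = (nu l 0%R i %% m i)%Z.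
Proof. by rewrite /rep raddfD mxE UE !mxE mulrN addrC mulrC. Qed.

Lemma rep_eq l l' : Gamma B (l - l') -> rep l = rep l'.
Proof.
move=> /GammaE H; apply: (bij_inj nu_bij); apply/rowP => i.
rewrite !nu_rep; apply/eqP; rewrite eqz_mod_dvd.
by have := H i; rewrite raddfB !mxE.
Qed.

Lemma quot_rep l : quot (rep l) = 0.
Proof. by rewrite quotD addNr. Qed.

Lemma rep_rep l : rep (rep l) = rep l.
Proof. by rewrite {1}/rep quot_rep oppr0 raddf0 raddf0 add0r. Qed.

Lemma hcomp_normalize l x : hcomp B l x -> hcomp B (rep l) (normalize x).
Proof.
move=> lx; rewrite (normalizeE lx).
by have [_ ch] := hfun_centroid (U (- quot l)); exact: ch.
Qed.

Lemma normalize_hfun q x : normalize (hfun (U q) x) = normalize x.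
Proof.
move: x; apply: linear_hcomp_eq.
- exact: (linear_compf normalize_linear (@hfunL _)).
- exact: normalize_linear.
move=> l x lx; have [_ ch] := hfun_centroid (U q).
rewrite (normalizeE (ch _ _ lx)) (normalizeE lx) quotD -hfunD -raddfD.
by rewrite opprD addrAC addNr add0r.
Qed.

Lemma normalize_idem x : normalize (normalize x) = normalize x.
Proof.
move: x; apply: linear_hcomp_eq.
- exact: (linear_compf normalize_linear normalize_linear).
- exact: normalize_linear.
by move=> l x lx; rewrite {1}(normalizeE lx) normalize_hfun.
Qed.

(** The units applied to homogeneous factors can be moved out of the product, where normalization
    absorbs them. *)
Lemma normalize_mul x y :
  normalize (amul (normalize x) (normalize y)) = normalize (amul x y).
Proof.
have nL := normalize_linear.
move: x; apply: linear_hcomp_eq.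
- exact: (linear_compf nL (linear_compf (@amul_linearl _ B (normalize y)) nL)).
- exact: (linear_compf nL (@amul_linearl _ B y)).
move=> l x lx; move: y; apply: linear_hcomp_eq.
- exact: (linear_compf nL (linear_compf (@amul_linearr _ B (normalize x)) nL)).
- exact: (linear_compf nL (@amul_linearr _ B x)).
move=> j y jy; rewrite (normalizeE lx) (normalizeE jy).
have [/centroidP[_ _ <-] _] := hfun_centroid (U (- quot l)).
have [/centroidP[_ <- _] _] := hfun_centroid (U (- quot j)).
by rewrite !normalize_hfun.
Qed.

Lemma normalize_inj l x : hcomp B l x -> normalize x = 0 -> x = 0.
Proof.
move=> lx; rewrite (normalizeE lx) => x0.
by rewrite -(hfunK (U (- quot l)) x) x0 (lin0 (@hfunL _)).
Qed.

Lemma gproj_normalize l x : gproj l (normalize x) != 0 -> rep l = l.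
Proof.
apply: contra_neqP => rl; move: x; apply: linear_hcomp_eq.
- exact: (linear_compf (@gproj_linear _ _ B l) normalize_linear).
- by move=> a x y; rewrite scaler0 addr0.
move=> j x jx; rewrite (gproj_id (hcomp_normalize jx)).
by case: eqP => // lj; case: rl; rewrite lj rep_rep.
Qed.

(** By graded centrality each component of c is zero or a scalar multiple of a unit [U q], and
    normalization absorbs the unit. *)
Lemma normalize_centroid c l x : centroid c -> hcomp B l x ->
  exists a, normalize (c x) = a *: normalize x.
Proof.
move=> cC lx; have nL := normalize_linear.
suff /choice[a aP] j : exists a, normalize (gproj j (c x)) = a *: normalize x.
  exists (\sum_(j <- gsupp (c x)) a j); rewrite {1}[c x]gproj_sum (lin_sum nL).
  by rewrite scaler_suml; apply: eq_bigr => j _; exact: aP.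
rewrite -[j](subrK l) -(ccompE _ cC lx).
have dC := centroid_ccomp (j - l) cC; move: (ccomp _ _) dC => d dC.
have [[y dy]|d0] := pselect (exists y, d y != 0); last first.
  exists 0; rewrite scale0r -[RHS](lin0 nL); congr normalize.
  by apply/eqP/negPn/negP => dx; apply: d0; exists x.
have /GammaE H : Gamma B (j - l) by apply/GammaP; exists d => //; exists y.
pose q : 'rV[int]_n := \row_i (nu (j - l) 0%R i %/ m i)%Z.
have qE : hdeg (U q) = j - l.
  apply: (bij_inj nu_bij); apply/rowP => i.
  by rewrite UE mxE mulrC divzK // H.
have qC := hfun_centroid (U q); rewrite qE in qC.
have [a aE] := centroid_comp_central hB hC qC (hfun_neq0 (U q)) dC.
by exists a; rewrite aE (linZ nL) normalize_hfun.
Qed.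

(** Splits the idempotent [normalize] through a finite dimensional space. Its image is spanned over
    k by the normalized components of generators of B over the centroid, as [normalize_centroid]
    turns central coefficients into scalars. *)
Lemma normalize_basis : exists r (p : B -> 'rV[k]_r) (s : 'rV[k]_r -> B),
  [/\ linear p, linear s, forall x, s (p x) = normalize x & forall v, p (s v) = v].
Proof.
have nL := normalize_linear; have [r0 [b bP]] := hF.
pose S := flatten [seq [seq normalize (gproj l (b i)) | l <- gsupp (b i)] | i : 'I_r0].
have [r [e [eP span free]]] : exists r (e : 'I_r -> B),
  [/\ forall i, normalize (e i) = e i,
    forall x, normalize x = x -> exists a : 'rV[k]_r, x = \sum_(i < r) a 0 i *: e i &
    forall a : 'rV[k]_r, \sum_(i < r) a 0 i *: e i = 0 -> a = 0].
  apply: (@finite_basis _ _ [set x | normalize x = x] S) => [v|x /= <-].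
    by move=> /flattenP[_ /mapP[i _ ->] /mapP[l _ ->]] /=; exact: normalize_idem.
  have [c [cC ->]] := bP x; rewrite (lin_sum nL); apply: lspan_sum => i _ _.
  have /centroidP[cL _ _] := cC i.
  rewrite {1}[b i]gproj_sum (lin_sum cL) (lin_sum nL); apply: lspan_sum => l li _.
  have [a ->] := normalize_centroid (cC i) (gproj_hcomp l (b i)).
  apply: lspanZ; apply: lspan_mem; apply/flattenP.
  exists [seq normalize (gproj l (b i)) | l <- gsupp (b i)].
    by apply/mapP; exists i; rewrite ?mem_enum.
  by apply/mapP; exists l.
pose s (a : 'rV[k]_r) := \sum_(i < r) a 0 i *: e i.
have sL : linear s.
  move=> a u v; rewrite scaler_sumr -big_split; apply: eq_bigr => i _.
  by rewrite !mxE scalerDl scalerA.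
have sI : injective s.
  move=> u v /eqP; rewrite -subr_eq0 -(linB sL) => /eqP/free/eqP.
  by rewrite subr_eq0 => /eqP.
have /choice[p pE] x : exists a, normalize x = s a.
  by apply: span; exact: normalize_idem.
have sN v : normalize (s v) = s v.
  rewrite (lin_sum nL); apply: eq_bigr => i _; by rewrite (linZ nL) eP.
exists r, p, s; split=> // [a x y|v]; apply: sI.
  by rewrite sL -!pE nL.
by rewrite -pE sN.
Qed.

End Normalization.

(** * The finite dimensional quotient A and its automorphisms *)

Section ImageMul.
Variables (k : fieldType) (B : algebra k) (V : lmodType k).
Variables (p : {linear B -> V}) (s : {linear V -> B}).

Definition image_mul (u v : V) : V := p (amul (s u) (s v)).

Lemma image_mul_bilinear : bilinear_for *:%R *:%R image_mul.
Proof.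
split=> [v a u u'|u a v v']; rewrite /image_mul linearP.
  by rewrite linearPl linearP.
by rewrite linearPr linearP.
Qed.

HB.instance Definition _ := bilinear_isBilinear.Build k V V V *:%R *:%R
  image_mul image_mul_bilinear.

End ImageMul.

Section CentralImage.
Variables (k : closedFieldType).
Variables (zeta : nat -> k) (zetaP : compatible_roots zeta).
Variables (Lam : zmodType) (B : gradedAlgebra k Lam) (hB : graded_simple B).
Variables (n : nat) (nu : {additive Lam -> 'rV[int]_n}) (m : 'I_n -> nat).
Hypotheses (nu_bij : bijective nu) (m0 : forall i, (0 < m i)%N).
Hypothesis GammaE : forall l, Gamma B l <-> forall i, (m i %| nu l 0%R i)%Z.
Variable U : {additive 'rV[int]_n -> hunit hB}.
Hypothesis UE : forall q i, nu (hdeg (U q)) 0 i = (m i)%:Z * q 0 i.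
Variable V : vectType k.
Variables (p : {linear B -> V}) (s : {linear V -> B}).
Hypothesis spE : forall x, s (p x) = normalize nu m U x.
Hypothesis psK : cancel s p.
Local Notation A := (@Algebra k V (image_mul p s)).
Local Notation z j := (zeta (m j)).

Let pL : linear p. Proof. exact: linearP. Qed.
Let sL : linear s. Proof. exact: linearP. Qed.

Let p_eq x y : normalize nu m U x = normalize nu m U y -> p x = p y.
Proof. by rewrite -!spE => /(can_inj psK). Qed.

Let pM x y : p (amul x y) = amul (p x : A) (p y).
Proof. by rewrite /= /image_mul !spE; apply: p_eq; rewrite (normalize_mul m0 UE). Qed.

Let p_inj l x : hcomp B l x -> p x = 0 -> x = 0.
Proof.
move=> lx px; apply: (normalize_inj (nu := nu) (m := m) (U := U) lx).
by rewrite -spE px linear0.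
Qed.

Let gproj_s l v : gproj l (s v) != 0 -> rep nu m U l = l.
Proof. by rewrite -{1}[v]psK spE; exact: (gproj_normalize m0 UE). Qed.

(** If v is a nonzero element of an ideal J, then s v lies in the preimage of J under p and its
    degrees lie in the box, where congruence modulo Gamma is equality. So [inequivalent_ideal_full]
    applies to this preimage. *)
Lemma central_image_simple : simple A.
Proof.
split.
  have [x [y xy]] := hB.1.
  suff [l [j [x' [y' [lx jy nz]]]]] : exists l j x' y',
      [/\ hcomp B l x', hcomp B j y' & amul x' y' != 0].
    exists (p x'), (p y'); rewrite -pM; apply: contra_neq nz.
    exact: (p_inj (hcomp_mul lx jy)).
  apply: contrapT => H; case/negP: xy; apply/eqP.
  move: x; apply: linear_hcomp_eq => [||l x lx].
  - exact: amul_linearl.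
  - by move=> a u v; rewrite scaler0 addr0.
  move: y; apply: linear_hcomp_eq => [||j y jy].
  - exact: amul_linearr.
  - by move=> a u v; rewrite scaler0 addr0.
  by apply/eqP/negPn/negP => xy; apply: H; exists l, j, x, y.
move=> J [[/set_mem J0 JP'] JM].
have JP a u v : J u -> J v -> J (a *: u + v).
  by move=> Ju Jv; apply/set_mem/JP'; exact/mem_set.
have [[v Jv v0]|nJ] := pselect (exists2 v, J v & v != 0); last first.
  left; apply/seteqP; split=> v /= => [Jv|->//].
  by apply/eqP/negPn/negP => v0; apply: nJ; exists v.
right; apply/seteqP; split=> // w _; rewrite -[w]psK.
apply: (@inequivalent_ideal_full _ _ _ hB [set x | J (p x)] (s v)).
- split=> [|b x /= Jx]; last by rewrite !pM; exact: JM.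
  split=> [|a x y]; first by rewrite inE /= linear0.
  by rewrite !inE /= => Jx Jy; rewrite linearP; exact: JP.
- by rewrite /= psK.
- by apply: contra_neq v0 => sv; rewrite -[v]psK sv linear0.
move=> l j /gproj_s {2}<- /gproj_s {2}<-.
exact: (rep_eq nu_bij GammaE UE).
Qed.

Let zm j : (m j).-primitive_root (z j).
Proof. exact: zetaP.1. Qed.

Let z0 j : z j != 0.
Proof.
apply/eqP => z0; have /eqP := prim_expr_order (zm j).
by rewrite z0 expr0n eqn0Ngt m0 eq_sym oner_eq0.
Qed.

(** The automorphism of B attached to a character of the grading group. The character is trivial on
    Gamma, so that the twist commutes with [normalize] and descends to A. *)
Let twist j : B -> B := glift (fun l x => z j ^ (nu l 0 j) *: x).

Let twistF j l a (x y : B) : hcomp B l x -> hcomp B l y ->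
  z j ^ (nu l 0 j) *: (a *: x + y) =
  a *: (z j ^ (nu l 0 j) *: x) + z j ^ (nu l 0 j) *: y.
Proof. by move=> _ _; rewrite scalerDr !scalerA mulrC. Qed.

Let twistE j l x : hcomp B l x -> twist j x = z j ^ (nu l 0 j) *: x.
Proof. by move=> lx; rewrite /twist (glift_hcomp (@twistF j) lx). Qed.

Let twist_linear j : linear (twist j). Proof. exact: glift_linear (@twistF j). Qed.

Let twistM j x y : twist j (amul x y) = amul (twist j x) (twist j y).
Proof.
have tL := @twist_linear j; move: x; apply: linear_hcomp_eq.
- exact: (linear_compf tL (@amul_linearl _ B y)).
- exact: (linear_compf (@amul_linearl _ B (twist j y)) tL).
move=> l x lx; move: y; apply: linear_hcomp_eq.
- exact: (linear_compf tL (@amul_linearr _ B x)).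
- exact: (linear_compf (@amul_linearr _ B (twist j x)) tL).
move=> i y iy; rewrite (twistE _ (hcomp_mul lx iy)) (twistE _ lx) (twistE _ iy).
by rewrite linearZl linearZr /= scalerA raddfD mxE expfzDr.
Qed.

Let iter_twist j b l x : hcomp B l x ->
  iter b (twist j) x = z j ^ (nu l 0 j * b%:Z) *: x.
Proof.
move=> lx; elim: b => [|b IH]; first by rewrite mulr0 expr0z scale1r.
rewrite iterS IH (linZ (@twist_linear j)) (twistE _ lx) scalerA -expfzDr //.
by rewrite intS mulrDr mulr1 addrC.
Qed.

Let twist_period j x : iter (m j) (twist j) x = x.
Proof.
move: x; apply: linear_hcomp_eq => [|//|l x lx].
  elim: (m j) => [//|b bL]; exact: (linear_compf (@twist_linear j) bL).
rewrite (iter_twist _ _ lx) mulrC -exprz_exp -exprnP (prim_expr_order (zm j)).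
by rewrite exp1rz scale1r.
Qed.

Let twist_normalize j x : twist j (normalize nu m U x) = normalize nu m U (twist j x).
Proof.
move: x; apply: linear_hcomp_eq.
- exact: (linear_compf (@twist_linear j) (normalize_linear _ _ _)).
- exact: (linear_compf (normalize_linear _ _ _) (@twist_linear j)).
move=> l x lx; rewrite (twistE _ lx) (linZ (normalize_linear _ _ _)).
rewrite (twistE _ (hcomp_normalize nu m U lx)); congr (_ *: _).
have E : nu l 0 j = (m j)%:Z * quot nu m l 0 j + nu (rep nu m U l) 0 j.
  by rewrite (nu_rep UE) mxE mulrC -divz_eq.
rewrite E expfzDr // -exprz_exp -exprnP (prim_expr_order (zm j)) exp1rz mul1r.
by [].
Qed.

Let sig j (v : V) : V := p (twist j (s v)).

Let sig_linear j : linear (sig j).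
Proof. exact: (linear_compf pL (linear_compf (@twist_linear j) sL)). Qed.

Let p_normalize x : p (normalize nu m U x) = p x.
Proof. by apply: p_eq; rewrite (normalize_idem m0 UE). Qed.

Let sig_p j x : sig j (p x) = p (twist j x).
Proof. by rewrite /sig spE twist_normalize p_normalize. Qed.

Let iter_sig_p j b x : iter b (sig j) (p x) = p (iter b (twist j) x).
Proof. by elim: b => //= b ->; rewrite sig_p. Qed.

Let sig_period j v : iter (m j) (sig j) v = v.
Proof. by rewrite -[v]psK iter_sig_p twist_period. Qed.

Let sig_bij j : bijective (sig j).
Proof.
exists (iter (m j).-1 (sig j)) => v.
  by rewrite -iterSr prednK // sig_period.
by rewrite -iterS prednK // sig_period.
Qed.

Let sigM j (u v : A) : sig j (amul u v) = amul (sig j u : A) (sig j v).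
Proof. by rewrite -[u]psK -[v]psK -pM !sig_p twistM pM. Qed.

Let sig_comm i j v : sig i (sig j v) = sig j (sig i v).
Proof.
rewrite -[v]psK !sig_p; congr (p _); move: (s v); apply: linear_hcomp_eq.
- exact: (linear_compf (@twist_linear i) (@twist_linear j)).
- exact: (linear_compf (@twist_linear j) (@twist_linear i)).
move=> l x lx; rewrite !(twistE _ lx) !(linZ (@twist_linear _)) !(twistE _ lx).
by rewrite !scalerA mulrC.
Qed.

Let sigA j : {linear A -> A} :=
  HB.pack (sig j) (GRing.isLinear.Build k A A *:%R (sig j) (@sig_linear j)).

Let D : multiloop_datum A n :=
  @MultiloopDatum k A n m m0
    (fun j => @Automorphism k A (sigA j) (@sigM j) (@sig_bij j))
    sig_comm sig_period.

Local Notation M := (multiloop zetaP D).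

Let eigen_p l x : hcomp B l x -> eigencomp zeta D (nu l) (p x).
Proof. by move=> lx j; rewrite /= sig_p (twistE _ lx) linearZ. Qed.

(** The eigenvalues of the twists on s v fix each of its degrees modulo Gamma. These degrees lie in
    the box, so s v is homogeneous of degree [rep l], and a unit moves it to degree l. *)
Let eigen_lift l v : eigencomp zeta D (nu l) v -> exists2 x, hcomp B l x & p x = v.
Proof.
move=> lv.
have tw j : twist j (s v) = z j ^ (nu l 0 j) *: s v.
  rewrite -[LHS](_ : normalize nu m U (twist j (s v)) = _); last first.
    by rewrite -twist_normalize -spE psK.
  by rewrite -spE -/(sig j v) -linearZ; congr (s _); exact: lv.
have gtw j t x : gproj t (twist j x) = z j ^ (nu t 0 j) *: gproj t x.
  move: x; apply: linear_hcomp_eq.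
  - exact: (linear_compf (@gproj_linear _ _ B t) (@twist_linear j)).
  - by apply: linear_scalef; exact: gproj_linear.
  move=> i x ix; rewrite (twistE _ ix) linearZ /= (gproj_id ix).
  by case: eqP => [->//|_]; rewrite !scaler0.
have sv : hcomp B (rep nu m U l) (s v).
  rewrite [s v]gproj_sum; apply: hcomp_sumr => t _ _.
  have [->|nz] := eqVneq (gproj t (s v)) 0; first exact: hcomp0.
  suff <- : t = rep nu m U l by exact: gproj_hcomp.
  rewrite -(gproj_s nz); apply: (rep_eq nu_bij GammaE UE); apply/GammaE => j.
  have /eqP := gtw j t (s v); rewrite tw linearZ /= -subr_eq0 -scalerBl.
  rewrite scaler_eq0 (negPf nz) orbF subr_eq0 => /eqP E.
  rewrite -(prim_exprz_eq1 _ (zm j)) raddfB !mxE expfzDr // -E -expfzDr //.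
  by rewrite subrr.
exists (hfun (U (quot nu m l)) (s v)).
  have [_ /(_ _ _ sv)] := hfun_centroid (U (quot nu m l)).
  by rewrite addrA -raddfD -raddfD subrr !raddf0 add0r.
by rewrite -[RHS]psK; apply: p_eq; rewrite (normalize_hfun m0 UE).
Qed.

(** The isomorphism sends x to the sum over l of p(x_l) z^(nu l), where x_l is the component of
    degree l. It is injective because p is so on components, and surjective by [eigen_lift]. *)
Lemma central_image_realization : multiloop_realization zetaP n B A.
Proof.
have [nu' nuK nu'K] := nu_bij.
pose c x (l : 'rV[int]_n) : A := p (gproj (nu' l) x).
have c_fin x : c x \in @fin_supported k A n.
  apply/fin_supportedP; apply: (@sub_finite_set _ _ [set nu l | l in [set` gsupp x]]).
    move=> l /= nz; exists (nu' l) => //=; apply: contraNT nz => /gproj_out E.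
    by rewrite /c E linear0.
  by apply: finite_image; exact: finite_seq.
have c_ml x : Laurent (c_fin x) \in multiloop_pred zeta D.
  apply/multiloop_predP => l /=; rewrite -{1}[l]nu'K; apply: eigen_p.
  exact: gproj_hcomp.
pose phi x : M := MultiloopType (c_ml x).
have phi_linear : linear phi.
  move=> a x y; apply: val_inj; apply: laurentP => l.
  by rewrite /= /c !linearP.
pose phiL : {linear B -> M} :=
  HB.pack phi (GRing.isLinear.Build k B M *:%R phi phi_linear).
have phi_tens l x : hcomp B l x -> mval (phi x) = tens (p x : A) (nu l).
  move=> lx; apply: laurentP => i; rewrite tensE /= /c (gproj_id lx).
  by rewrite (can2_eq nu'K nuK); case: ifP => // _; rewrite linear0.
have phi_lift f : exists x, phi x = f.
  have /choice[x xP] (l : 'rV[int]_n) : exists x, hcomp B (nu' l) x /\ p x = mval f l.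
    have /multiloop_predP/(_ l) := mvalP f; rewrite -{1}[l]nu'K.
    by move=> /eigen_lift[x lx <-]; exists x.
  exists (\sum_(l <- lsupp (mval f)) x l); rewrite (lin_sum phi_linear).
  apply: val_inj; rewrite /= mval_sum [RHS]laurent_tens; apply: eq_bigr => l _.
  by have [lx <-] := xP l; rewrite (phi_tens _ _ lx) nu'K.
have phi_inj : injective phi.
  move=> x y xy; apply: gproj_eq => l; apply/eqP; rewrite -subr_eq0 -linearB.
  apply/eqP; apply: (p_inj (gproj_hcomp l _)).
  have : mval (phi (x - y)) (nu l) = 0.
    by rewrite (linB phi_linear) xy subrr.
  by rewrite /= /c nuK.
have [g gK] := choice phi_lift.
have phi_bij : bijective phi.
  by exists g => [x|//]; apply: phi_inj; rewrite gK.
exists D, phiL, nu; split=> // [x y|l].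
  move: x; apply: linear_hcomp_eq.
  - exact: (linear_compf phi_linear (@amul_linearl _ B y)).
  - exact: (linear_compf (@amul_linearl _ M (phi y)) phi_linear).
  move=> l x lx; move: y; apply: linear_hcomp_eq.
  - exact: (linear_compf phi_linear (@amul_linearr _ B x)).
  - exact: (linear_compf (@amul_linearr _ M (phi x)) phi_linear).
  move=> i y iy; apply: val_inj.
  rewrite -[LHS]/(mval (phi (amul x y))).
  rewrite -[RHS]/(laurent_mul (mval (phi x)) (mval (phi y))).
  rewrite (phi_tens _ _ (hcomp_mul lx iy)) pM raddfD -tens_mul.
  by rewrite (phi_tens _ _ lx) (phi_tens _ _ iy).
apply/seteqP; split=> [_ [x lx <-]|f [u lu uf]].
  by exists (p x); [exact: eigen_p|rewrite -phi_tens].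
have [x lx xu] := eigen_lift lu; exists x => //.
by apply: val_inj; rewrite /= -uf -xu -phi_tens.
Qed.

End CentralImage.

(** * Sufficiency of the conditions, and the criterion on the support *)

Lemma conditions_realization (k : closedFieldType) (zeta : nat -> k)
    (zetaP : compatible_roots zeta) (n : nat) (Lam : zmodType)
    (B : gradedAlgebra k Lam) :
  free_of_rank Lam n -> graded_central_simple B -> fgc B ->
  finite_index (Gamma B) -> fd_simple_realization zetaP n B.
Proof.
move=> LamP [hC hB] hF hG.
have [nu [m [nu_bij m0 GammaE]]] :=
  subgroup_coordinates LamP (Gamma0 hB) (GammaD hB) (GammaN hB) hG.
have [U UE] := hunit_lattice hB nu_bij GammaE.
have [r [p [s [pL sL spE psK]]]] := normalize_basis hC hF nu_bij m0 GammaE UE.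
pose V : vectType k := 'rV[k]_r.
pose pA : {linear B -> V} := HB.pack p (GRing.isLinear.Build _ _ _ _ p pL).
pose sA : {linear V -> B} := HB.pack s (GRing.isLinear.Build _ _ _ _ s sL).
exists V, (image_mul pA sA); split.
  exact: (@central_image_simple _ _ _ _ _ _ _ nu_bij m0 GammaE _ UE V pA sA spE psK).
exact: (@central_image_realization _ _ zetaP _ _ _ _ _ _ nu_bij m0 GammaE _ UE V
  pA sA spE psK).
Qed.

(** Write l = b + N q with b in a finite box. Since N q is in the support, it is congruent modulo
    Gamma to one of finitely many t, and l is congruent to b + t. *)
Lemma supp_finite_index (k : fieldType) (Lam : zmodType) (n N : nat)
    (B : gradedAlgebra k Lam) :
  free_of_rank Lam n -> graded_simple B -> fgc B -> (0 < N)%N ->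
  (forall x, supp B (x *+ N)) -> finite_index (Gamma B).
Proof.
move=> [e [g eK gK]] hB hF N0 suppN.
have [s sP] := fgc_supp hF.
pose f (c : 'rV[int]_n) := \sum_(i < n) e i *~ c 0 i.
pose box := [seq f (\row_i (h i : nat)%:Z) | h : {ffun 'I_n -> 'I_N.-1.+1}].
apply: (@finite_cosets _ _ [seq b + t | b <- box, t <- s]).
- exact: Gamma0.
- exact: GammaD.
- exact: GammaN.
move=> l; pose q : 'rV[int]_n := \row_i (g l 0%R i %/ N)%Z.
pose h : {ffun 'I_n -> 'I_N.-1.+1} := [ffun i => inord (absz (g l 0%R i %% N)%Z)].
pose b := f (\row_i (h i : nat)%:Z).
have lE : l = b + f q *+ N.
  rewrite -{1}[l]gK /b /f -sumrMnl -big_split; apply: eq_bigr => i _ /=.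
  rewrite !mxE ffunE inordK; last first.
    rewrite prednK // -ltz_nat gez0_abs ?ltz_pmod ?modz_ge0 //.
    by rewrite gt_eqF.
  rewrite gez0_abs ?modz_ge0 ?gt_eqF //.
  by rewrite pmulrn -mulrzA -mulrzDr addrC -divz_eq.
have [t ts Gt] := sP _ (suppN (f q)).
exists (b + t); last by rewrite lE opprD addrACA subrr add0r.
apply/allpairsP; exists (b, t); split=> //=.
by apply/mapP; exists h; rewrite ?mem_enum.
Qed.

Theorem corollary8p3p5
    (k : closedFieldType) (char0 : [pchar k] =i pred0)
    (zeta : nat -> k) (zetaP : compatible_roots zeta)
    (n : nat) (n_gt0 : (0 < n)%N)
    (Lam : zmodType) (LamP : free_of_rank Lam n)
    (B : gradedAlgebra k Lam) :
  (fd_simple_realization zetaP n B <->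
     [/\ graded_central_simple B, fgc B & finite_index (Gamma B)])
  /\
  ((exists2 l : nat, (0 < l)%N & forall x : Lam, supp B (x *+ l)) ->
     (fd_simple_realization zetaP n B <->
        graded_central_simple B /\ fgc B)).
Proof.
have main : fd_simple_realization zetaP n B <->
    [/\ graded_central_simple B, fgc B & finite_index (Gamma B)].
  split=> [|[hCS hF hG]]; last exact: conditions_realization.
  move=> [V [mulV [simpleA [D [phi [nu [phi_bij nu_bij phiM phi_hcomp]]]]]]].
  exact: (realization_conditions char0 simpleA phi_bij nu_bij phiM phi_hcomp).
split=> // -[N N0 suppN]; split=> [/main[]//|[hCS hF]].
apply/main; split=> //; apply: supp_finite_index LamP _ hF N0 suppN.
exact: hCS.2.
Qed.
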